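(* The sesquilinear form $\mathfrak a\colon\mathcal V\times\mathcal V\to\mathbb C$ given, for $\mathbf z_1=[u;\mathbf x]$, $\mathbf z_2=[v;\mathbf y]\in\mathcal V$, by $$\mathfrak a(\mathbf z_1,\mathbf z_2):=\int_\Omega\nabla_{\mathbf k}u\cdot\overline{\nabla_{\mathbf k}v}\,dx+\Xi\int_{\Omega_2}u\overline v\,dx-\sum_{\ell=1}^L\xi_\ell\eta_\ell\int_{\Omega_2}x_\ell\overline v\,dx-\sum_{\ell=1}^L\xi_\ell\eta_\ell\int_{\Omega_2}u\,\overline{y_\ell}\,dx+\sum_{\ell=1}^L\eta_\ell^2(x_\ell,y_\ell)_X$$ is continuous and Hermitian (so $\mathfrak a(\mathbf z,\mathbf z)\in\mathbb R$ for all $\mathbf z\in\mathcal V$), and satisfies a Gårding inequality: there exist real constants $\alpha>0$ and $\beta\ge0$ such that $$\mathfrak a(\mathbf z,\mathbf z)\ge\alpha\|\mathbf z\|_{\mathcal V}^2-\beta\,\mathfrak i(\mathbf z,\mathbf z)\qquad\text{for all }\mathbf z\in\mathcal V.$$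
   Context: Setting: $\Omega\subset\mathbb R^2$ is a bounded domain (Wigner–Seitz cell of a periodic lattice), decomposed into disjoint subdomains $\Omega=\Omega_1\cup\Omega_2$. Constants $\alpha_1,\alpha_2>0$ and real $\xi_\ell,\eta_\ell$ ($\ell=1,\dots,L$) are given, $\Xi:=\sum_\ell\xi_\ell^2$, $\mathbf k\in\mathbb R^2$ is fixed, $\nabla_{\mathbf k}:=\nabla+i\mathbf k$. $V:=H^1_{\rm per}(\Omega)$ with the standard $H^1$-norm; $X:=\{v\in L^2(\Omega): v=0\text{ on }\Omega_1\}$ with $(u,v)_X:=\int_{\Omega_2}u\overline v\,dx$; $\mathcal V:=V\times X^L$ with $\|[u;\mathbf x]\|_{\mathcal V}^2:=\|u\|_V^2+\sum_\ell\|x_\ell\|_X^2$. Further $$\mathfrak i([u;\mathbf x],[v;\mathbf y]):=\alpha_1\int_{\Omega_1}u\overline v\,dx+\alpha_2\int_{\Omega_2}u\overline v\,dx+\sum_{\ell=1}^L(x_\ell,y_\ell)_X ,$$ which is an inner product on $\mathcal H:=L^2(\Omega)\times X^L$ and plays the role of the pivot inner product. *)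

(* Defs.v *)
From HB Require Import structures.
From mathcomp Require Import all_boot all_order all_algebra.
From mathcomp Require Import all_classical all_reals all_analysis.
From mathcomp Require Import complex.

Set Implicit Arguments.
Unset Strict Implicit.
Unset Printing Implicit Defensive.

Import Order.TTheory GRing.Theory Num.Theory.
Import numFieldNormedType.Exports.

Local Open Scope classical_set_scope.
Local Open Scope ring_scope.
Local Open Scope complex_scope.

Section Plane.
Context {R : realType}.

(* [measurableTypeR R] is [R] with the sigma-algebra that carries
   [lebesgue_measure]. *)
Definition plane := (measurableTypeR R * measurableTypeR R)%type.

Definition leb2 : {measure set plane -> \bar R} :=
  (@lebesgue_measure R \x @lebesgue_measure R)%E.

Definition coord (p : R * R) (j : 'I_2) : R := if j == ord0 then p.1 else p.2.

Definition unit_vec (j : 'I_2) : R * R := ((j == 0)%:R, (j == 1)%:R).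

(* The canonical norm of [R * R] in the library is the sup norm, hence the
   explicit Euclidean scalar product. *)
Definition dot2 (x y : R * R) : R := \sum_(j < 2) coord x j * coord y j.

(* Complex-valued functions; [^o] only serves to make the function spaces
   left modules over [R[i]]. *)
Definition cfun := R * R -> R[i]^o.

(* Integrals of complex-valued functions are taken componentwise. *)
Definition cintegral (D : set (R * R)) (f : cfun) : R[i] :=
  (\int[leb2]_(x in D) complex.Re (f x)) +i*
  (\int[leb2]_(x in D) complex.Im (f x)).

(* Elements of Lebesgue and Sobolev spaces are represented by functions, not
   by their classes modulo almost everywhere equality. *)
Definition L2 (D : set (R * R)) (f : cfun) : Prop :=
  [/\ measurable_fun (D : set plane) (fun x : plane => complex.Re (f x)),
      measurable_fun (D : set plane) (fun x : plane => complex.Im (f x)) &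
      (\int[leb2]_(x in D) (Normc.normc (f x) ^+ 2)%:E < +oo)%E].

Definition L2loc (f : cfun) : Prop :=
  forall K : set (R * R), compact K -> L2 K f.

Definition iter_partial (s : seq 'I_2) (phi : R * R -> R) : R * R -> R :=
  foldr (fun j f x => 'D_(unit_vec j) f x) phi s.

Definition smooth (phi : R * R -> R) : Prop :=
  forall s : seq 'I_2,
    continuous (iter_partial s phi) /\
    forall j x, derivable (iter_partial s phi) x (unit_vec j).

Definition test_function (phi : R * R -> R) : Prop :=
  smooth phi /\ compact (closure [set x | phi x != 0]).

Definition is_weak_partial (j : 'I_2) (u g : cfun) : Prop :=
  L2loc g /\
  forall phi, test_function phi ->
    cintegral setT (fun x => u x * ('D_(unit_vec j) phi x)%:C) =
    - cintegral setT (fun x => g x * (phi x)%:C).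

(* The weak partial derivative; it is only determined almost everywhere, and a
   representative is chosen. *)
Definition weak_partial (j : 'I_2) (u : cfun) : cfun :=
  xget (cst 0) [set g | is_weak_partial j u g].

Definition H1loc (u : cfun) : Prop :=
  L2loc u /\ forall j, exists g, is_weak_partial j u g.

Definition lattice (a1 a2 : R * R) : set (R * R) :=
  [set x | exists m n : int, x = a1 *~ m + a2 *~ n].

(* The open cell: points strictly closer to 0 than to any other lattice
   point. *)
Definition wigner_seitz (a1 a2 : R * R) : set (R * R) :=
  [set x | forall l, lattice a1 a2 l -> l != 0 ->
     dot2 x x < dot2 (x - l) (x - l)].

(* [H^1_per] of the cell: as usual, a function on the cell is identified with
   its periodic extension to the plane, which has to be locally H^1. *)
Definition H1per (a1 a2 : R * R) : set cfun :=
  [set u | H1loc u /\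
     forall l, lattice a1 a2 l -> {ae leb2, forall x, u (x + l) = u x}].

Definition Xspace (Omega Omega1 : set (R * R)) : set cfun :=
  [set v | L2 Omega v /\ {ae leb2, forall x, Omega1 x -> v x = 0}].

(* [Omega] is split up to a null set, so that the pieces may be open sets
   separated by an interface. *)
Definition decomposition (Omega Omega1 Omega2 : set (R * R)) : Prop :=
  [/\ measurable (Omega1 : set plane) /\ measurable (Omega2 : set plane),
      Omega1 `<=` Omega /\ Omega2 `<=` Omega,
      Omega1 `&` Omega2 = set0 &
      leb2.-negligible (Omega `\` (Omega1 `|` Omega2))].

Definition gradk (k : R * R) (u : cfun) (j : 'I_2) : cfun :=
  fun x => weak_partial j u x + (0 +i* coord k j) * u x.

Definition innerX (Omega2 : set (R * R)) (x y : cfun) : R[i] :=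
  cintegral Omega2 (fun p => x p * conjc (y p)).

Definition normX_sq (Omega2 : set (R * R)) (x : cfun) : R :=
  \int[leb2]_(p in Omega2) (Normc.normc (x p) ^+ 2).

Definition normV_sq (Omega : set (R * R)) (u : cfun) : R :=
  \int[leb2]_(x in Omega) (Normc.normc (u x) ^+ 2) +
  \sum_(j < 2) \int[leb2]_(x in Omega) (Normc.normc (weak_partial j u x) ^+ 2).

Section Product.
Variable L : nat.

Definition pairs := (cfun * ('I_L -> cfun))%type.

Definition VX (a1 a2 : R * R) (Omega1 : set (R * R)) : set pairs :=
  [set z | H1per a1 a2 z.1 /\
     forall l, Xspace (wigner_seitz a1 a2) Omega1 (z.2 l)].

Definition normVX (Omega Omega2 : set (R * R)) (z : pairs) : R :=
  Num.sqrt (normV_sq Omega z.1 + \sum_(l < L) normX_sq Omega2 (z.2 l)).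

Definition form_i (alpha1 alpha2 : R) (Omega1 Omega2 : set (R * R))
    (z1 z2 : pairs) : R[i] :=
  let: (u, x) := z1 in let: (v, y) := z2 in
  alpha1%:C * cintegral Omega1 (fun p => u p * conjc (v p)) +
  alpha2%:C * cintegral Omega2 (fun p => u p * conjc (v p)) +
  \sum_(l < L) innerX Omega2 (x l) (y l).

Definition form_a (xi eta : 'I_L -> R) (k : R * R)
    (Omega Omega2 : set (R * R)) (z1 z2 : pairs) : R[i] :=
  let: (u, x) := z1 in let: (v, y) := z2 in
  let Xi := \sum_(l < L) xi l ^+ 2 in
  cintegral Omega (fun p => \sum_(j < 2) gradk k u j p * conjc (gradk k v j p)) +
  Xi%:C * cintegral Omega2 (fun p => u p * conjc (v p)) -
  \sum_(l < L) (xi l * eta l)%:C * cintegral Omega2 (fun p => x l p * conjc (v p)) -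
  \sum_(l < L) (xi l * eta l)%:C * cintegral Omega2 (fun p => u p * conjc (y l p)) +
  \sum_(l < L) (eta l ^+ 2)%:C * innerX Omega2 (x l) (y l).

End Product.
End Plane.

Section Forms.
Context {R : realType} {E : lmodType R[i]}.
Variables (S : set E) (a : E -> E -> R[i]).

Definition sesquilinear_on : Prop :=
  (forall (c : R[i]) z1 z2 z, S z1 -> S z2 -> S z ->
     a (c *: z1 + z2) z = c * a z1 z + a z2 z) /\
  (forall (c : R[i]) z z1 z2, S z -> S z1 -> S z2 ->
     a z (c *: z1 + z2) = conjc c * a z z1 + a z z2).

Definition continuous_form_on (nrm : E -> R) : Prop :=
  exists C : R, forall z1 z2, S z1 -> S z2 ->
    Normc.normc (a z1 z2) <= C * nrm z1 * nrm z2.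

Definition hermitian_on : Prop :=
  forall z1 z2, S z1 -> S z2 -> a z1 z2 = conjc (a z2 z1).

End Forms.

(* Main.v *)
Require Import Defs.
From HB Require Import structures.
From mathcomp Require Import all_boot all_order all_algebra.
From mathcomp Require Import all_classical all_reals all_analysis.
From mathcomp Require Import complex.
From mathcomp Require Import measurable_realfun ring lra.

Set Implicit Arguments.
Unset Strict Implicit.
Unset Printing Implicit Defensive.

Import Order.TTheory GRing.Theory Num.Theory.
Import numFieldNormedType.Exports.

Local Open Scope classical_set_scope.
Local Open Scope ring_scope.
Local Open Scope complex_scope.

(** The form is a sum of pairings [\int_D P z1 * conj (Q z2)] of maps [P], [Q]
    that are linear up to null sets and bounded from [V] into [L2 D], so
    sesquilinearity and continuity (by Cauchy-Schwarz) pass from the pairings to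
    the form. Linearity of [z |-> gradk k z.1 j] is the delicate point: the weak
    derivative is a chosen representative, and two of them agree almost
    everywhere by the fundamental lemma of the calculus of variations. For the
    latter, the smooth functions
    [e(n(x-a)) e(n(b-x)) e(n(y-c)) e(n(d-y))] with [e(t) = exp(-1/t)] for [t > 0]
    and [0] otherwise are bounded by 1 and converge to the indicator of the open
    box with corners [(a, c)] and [(b, d)], and open boxes are a pi-system generating the Borel sets.
    In the Garding inequality, the zeroth-order terms of [a z z] sum up to
    [\int_Omega2 \sum_l |xi_l u - eta_l x_l|^2 >= 0], while
    [|grad_k u|^2 >= |grad u|^2 / 2 - |k|^2 |u|^2] pointwise. *)

(** * Smooth bump functions *)

(** The term [y^n / n!] of the exponential series is at most [expR y], so [n!] is an admissible
    constant. *)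
Lemma exprn_expRN_bounded (R : realType) (n : nat) :
  exists C : R, forall y, 0 < y -> `|y ^+ n * expR (- y)| <= C.
Proof.
exists (n`!%:R) => y y0; have y0' := ltW y0.
rewrite ger0_norm ?mulr_ge0 ?exprn_ge0 ?expR_ge0//.
rewrite expRN ler_pdivrMr ?expR_gt0//; case: n => [|n].
  by rewrite expr0 fact0 mul1r -expR0 ler_expR.
have := expR_ge1Dxn n y0'; set f := n.+1`!%:R => h.
have f0 : 0 < f by rewrite ltr0n fact_gt0.
by rewrite mulrC -ler_pdivrMr//; apply: le_trans h; rewrite lerDr.
Qed.

Lemma horner_expRN_bounded (R : realType) (p : {poly R}) :
  exists C : R, forall y, 0 < y -> `|p.[y] * expR (- y)| <= C.
Proof.
(* The additional power of [y] makes the induction work: splitting off the constant coefficient of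
   [p] moves one factor [y] into it. *)
suff H n : exists C : R, forall y, 0 < y -> `|p.[y] * y ^+ n * expR (- y)| <= C.
  by have [C HC] := H 0; exists C => y /HC; rewrite expr0 mulr1.
elim/poly_ind: p n => [|p c IH] n.
  by exists 0 => y _; rewrite horner0 !mul0r normr0.
have [C HC] := IH n.+1; have [D HD] := exprn_expRN_bounded R n.
exists (C + `|c| * D) => y y0; rewrite !hornerE.
rewrite mulrDl mulrDl -(mulrA _ y) -exprS -(mulrA c).
by rewrite (le_trans (ler_normD _ _))// lerD ?HC// normrM ler_wpM2l ?HD.
Qed.

Definition flat (R : realType) (p : {poly R}) (t : R) : R :=
  if 0 < t then p.[t^-1] * expR (- t^-1) else 0.

(** Comes from the boundedness of [y^2 p(y) exp(-y)] at [y = 1/t]. The quadratic decay gives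
    continuity and a zero derivative at the origin. *)
Lemma flat_quadratic (R : realType) (p : {poly R}) :
  exists C : R, forall t, `|flat p t| <= C * t ^+ 2.
Proof.
have [C HC] := horner_expRN_bounded ('X^2 * p).
have C0 : 0 <= C by apply: le_trans (HC 1 ltr01).
exists C => t; rewrite /flat; case: ifPn => t0; last by rewrite normr0 mulr_ge0// sqr_ge0.
have := HC t^-1; rewrite invr_gt0 hornerM hornerXn => /(_ t0).
rewrite -mulrA normrM [`|_ ^+ 2|]ger0_norm ?sqr_ge0// exprVn.
by rewrite ler_pdivrMl ?exprn_gt0// (mulrC _ C).
Qed.

(** For [t > 0] the inner derivatives of [1/t] and [-1/t] contribute a factor [t^-2], which is
    ['X^2] evaluated at [1/t]; this is why the derivative is again of the form [flat]. At 0 the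
    difference quotient is squeezed between multiples of [|h|]. *)
Lemma is_derive_flat (R : realType) (p : {poly R}) (t : R) :
  is_derive t 1 (flat p) (flat ('X^2 * (p - p^`())) t).
Proof.
have [t0|t0|->] := ltgtP t 0.
- apply: (@near_eq_is_derive _ _ _ (cst 0)).
    near=> s; rewrite /flat ifF//; apply/negbTE; rewrite -leNgt ltW//.
    by near: s; exact: lt_nbhsl.
  by rewrite /flat ifF ?(lt_gtF t0)//; exact: is_derive_cst.
- apply: (@near_eq_is_derive _ _ _
    (fun s : R => p.[s^-1] * expR (- s^-1))).
    near=> s; rewrite /flat ifT//.
    by near: s; exact: lt_nbhsr.
  rewrite /flat t0.
  have tN0 : t != 0 by rewrite gt_eqF.
  have dV : is_derive t 1 (@GRing.inv R) (- t ^- 2).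
    have := @is_deriveV R id t 1 1 tN0 (is_derive_id _ _).
    by rewrite scaler1.
  have d1 : is_derive t 1 (fun s : R => p.[s^-1]) (- t ^- 2 * p^`().[t^-1]).
    have := @is_derive1_comp R (horner p) (@GRing.inv R) t _ _ (is_derive_poly p _) dV.
    by rewrite mulrC.
  have d2 : is_derive t 1 (fun s : R => expR (- s^-1)) (t ^- 2 * expR (- t^-1)).
    have := @is_derive1_comp R expR (fun s => - s^-1) t _ _ (is_derive_expR _) (is_deriveN dV).
    by rewrite opprK mulrC.
  apply: (is_derive_eq (is_deriveM d1 d2)).
  rewrite !hornerE /GRing.scale /= exprVn; ring.
have [C HC] := flat_quadratic p.
have E0 q : flat q 0 = 0 :> R by rewrite /flat ltxx.
rewrite E0.
suff H : (fun h : R => h^-1 *: ((flat p \o shift 0) (h *: (1:R)) - flat p 0))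
    @ 0^' --> (0 : R).
  apply: DeriveDef; first by apply/cvg_ex; exists 0.
  by rewrite /derive; exact: cvg_lim.
rewrite E0.
have H0 : C * `|h| @[h --> (0:R)^'] --> (0 : R).
  rewrite -[X in _ --> X](mulr0 C) -[X in _ --> C * X](@normr0 _ R).
  apply: cvgM; [exact: cvg_cst|apply: cvg_norm].
  by apply: cvg_within_filter; exact: cvg_id.
apply: (@squeeze_cvgr _ _ _ _ (fun h : R => - (C * `|h|)) (fun h => C * `|h|)) => //.
  near=> h; rewrite -ler_norml /= addr0 subr0 [h *: 1]mulr1 normrM normfV.
  have h0 : h != 0 by near: h; exact: nbhs_dnbhs_neq.
  by rewrite ler_pdivrMl ?normr_gt0// mulrCA -expr2 real_normK ?num_real//.
by rewrite -[X in _ --> X]oppr0; apply: cvgN.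
Unshelve. all: by end_near. Qed.
(* Closed under both partial derivatives, which is what makes its members
   smooth in the iterated sense of [smooth]. *)
Inductive flat_algebra (R : realType) : (R * R -> R) -> Prop :=
| flat_algebra_gen p c d j : flat_algebra (fun z => flat p (c * Defs.coord z j + d))
| flat_algebra_cst c : flat_algebra (fun=> c)
| flat_algebraD f g : flat_algebra f -> flat_algebra g -> flat_algebra (f + g)
| flat_algebraM f g : flat_algebra f -> flat_algebra g -> flat_algebra (f * g).

(** Reduces directional derivatives to derivatives in one real variable, where the chain rule is
    applied. *)
Lemma is_derive_line (R : realType) (V : normedModType R) (f : V -> R)
    (x v : V) (df : R) :
  is_derive (0 : R) 1 (fun h : R => f (h *: v + x)) df -> is_derive x v f df.
Proof.
move=> [d1 d2]; apply: DeriveDef; first exact/derivable1P.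
rewrite -d2 /derive.
suff -> : (fun h : R => h^-1 *: ((f \o shift x) (h *: v) - f x)) =
  (fun h => h^-1 *: (((fun h : R => f (h *: v + x)) \o shift 0) (h *: (1 : R)) -
                     f (0 *: v + x))) by [].
apply/funext => h /=.
by rewrite addr0 scale0r add0r [_%:A]mulr1.
Qed.

Lemma continuous_coord (R : realType) (j : 'I_2) :
  continuous (fun z : R * R => Defs.coord z j).
Proof.
rewrite /Defs.coord; case: (j == ord0) => z; [exact: cvg_fst|exact: cvg_snd].
Qed.

Lemma continuous_flat_algebra (R : realType) (f : R * R -> R) :
  flat_algebra f -> continuous f.
Proof.
elim=> [p c d j|c|{}f g _ cf _ cg|{}f g _ cf _ cg] z.
- apply: (@continuous_comp _ _ _ (fun z => c * Defs.coord z j + d) (flat p)).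
    apply: cvgD; last exact: cvg_cst.
    by apply: cvgM; [exact: cvg_cst|exact: continuous_coord].
  apply/differentiable_continuous/derivable1_diffP.
  by case: (is_derive_flat p (c * Defs.coord z j + d)).
- exact: cvg_cst.
- by apply: cvgD; [exact: cf|exact: cg].
- by apply: cvgM; [exact: cf|exact: cg].
Qed.

Lemma flat_algebra_is_derive (R : realType) (f : R * R -> R) (j : 'I_2) :
  flat_algebra f ->
  exists2 g, flat_algebra g & forall z, is_derive z (unit_vec j) f (g z).
Proof.
elim=> [p c d i|c|{}f g ff [f' ff' df] fg [g' fg' dg]|{}f g ff [f' ff' df] fg [g' fg' dg]].
(* Along the line in direction [unit_vec j] the argument of [flat p] is affine with slope [e], which
   is [c] if [i = j] and 0 otherwise. *)
- set e := c * Defs.coord (unit_vec j) i.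
  exists ((fun=> e) * (fun z => flat ('X^2 * (p - p^`())) (c * Defs.coord z i + d))).
    by apply: flat_algebraM; [exact: flat_algebra_cst|exact: flat_algebra_gen].
  move=> z; apply: is_derive_line.
  have -> : (fun h : R => flat p (c * Defs.coord (h *: unit_vec j + z) i + d)) =
      flat p \o (fun h => e * h + (c * Defs.coord z i + d)).
    apply/funext => h /=; congr (flat p _); rewrite /e /Defs.coord.
    by case: ifP => _ /=; rewrite /GRing.scale/=; ring.
  rewrite [X in is_derive _ _ _ X]mulrC; set y := c * _ + d.
  apply: is_derive1_comp; first by rewrite mulr0 add0r; exact: is_derive_flat.
  have /is_derive_eq : is_derive (0 : R) 1 (fun h => e * h + y) (e *: 1 + 0).
    by apply: is_deriveD.
  by apply; rewrite scaler1 addr0.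
- by exists (fun=> 0); [exact: flat_algebra_cst|move=> z; exact: is_derive_cst].
- exists (f' + g'); first exact: flat_algebraD.
  by move=> z; exact: (is_deriveD (df z) (dg z)).
- exists (f * g' + g * f'); first by apply: flat_algebraD; exact: flat_algebraM.
  by move=> z; exact: (is_deriveM (df z) (dg z)).
Qed.

Lemma smooth_flat_algebra (R : realType) (f : R * R -> R) :
  flat_algebra f -> smooth f.
Proof.
move=> ff s; have fs : flat_algebra (iter_partial s f).
  elim: s => //= j s /(flat_algebra_is_derive j)[g fg dg].
  by rewrite (_ : (fun x => _) = g)//; apply/funext => x; case: (dg x).
split; first exact: continuous_flat_algebra.
by move=> j x; have [g _ /(_ x)[]] := flat_algebra_is_derive j fs.
Qed.

Definition box (R : realType) (p q : R * R) : set (R * R) :=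
  `]p.1, q.1[ `*` `]p.2, q.2[.

(** The dilation factor is [n.+1] so that it is never zero, and the arguments are expanded to the
    shape [c * coord z j + d] of [flat_algebra_gen]; [box_bumpE] gives the factored form. *)
Definition box_bump_side (R : realType) (n : nat) (a b : R) (j : 'I_2) (z : R * R) : R :=
  flat 1 (n.+1%:R * Defs.coord z j + - (n.+1%:R * a)) *
  flat 1 (- n.+1%:R * Defs.coord z j + n.+1%:R * b).

Definition box_bump (R : realType) (n : nat) (p q : R * R) : R * R -> R :=
  box_bump_side n p.1 q.1 0 * box_bump_side n p.2 q.2 1.

Lemma flat1_ge0 (R : realType) (t : R) : 0 <= flat 1 t.
Proof. by rewrite /flat; case: ifP => // _; rewrite hornerC mul1r expR_ge0. Qed.

Lemma flat1_le1 (R : realType) (t : R) : flat 1 t <= 1.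
Proof.
rewrite /flat; case: ifPn => // t0.
by rewrite hornerC mul1r expR_le1 oppr_le0 invr_ge0 ltW.
Qed.

Lemma cvg_flat1 (R : realType) (s : R) : 0 < s ->
  flat 1 (n.+1%:R * s) @[n --> \oo] --> (1 : R).
Proof.
move=> s0; have -> : (fun n => flat 1 (n.+1%:R * s)) =
    (fun n => expR (- (n.+1%:R^-1 * s^-1))).
  apply/funext => n; rewrite /flat ifT ?mulr_gt0//.
  by rewrite hornerC mul1r invfM.
rewrite -[X in _ --> X]expR0 -[X in _ --> expR X]oppr0 -[X in _ --> expR (- X)](mul0r s^-1).
apply: continuous_cvg; first exact: continuous_expR.
apply: cvgN; apply: cvgM; last exact: cvg_cst.
exact: cvg_harmonic.
Qed.

Lemma box_bumpE (R : realType) n (p q z : R * R) : box_bump n p q z =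
  (flat 1 (n.+1%:R * (z.1 - p.1)) * flat 1 (n.+1%:R * (q.1 - z.1))) *
  (flat 1 (n.+1%:R * (z.2 - p.2)) * flat 1 (n.+1%:R * (q.2 - z.2))).
Proof.
rewrite /box_bump /box_bump_side /Defs.coord/=.
by congr ((flat _ _ * flat _ _) * (flat _ _ * flat _ _)); ring.
Qed.

Lemma box_bump_ge0 (R : realType) n (p q z : R * R) : 0 <= box_bump n p q z.
Proof. by rewrite box_bumpE !mulr_ge0 ?flat1_ge0. Qed.

Lemma box_bump_le1 (R : realType) n (p q z : R * R) : box_bump n p q z <= 1.
Proof.
by rewrite box_bumpE !mulr_ile1 ?mulr_ge0 ?flat1_ge0 ?flat1_le1.
Qed.

Lemma box_bump_out (R : realType) n (p q z : R * R) :
  ~ box p q z -> box_bump n p q z = 0.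
Proof.
move=> zb; apply/eqP/negP => /negP; rewrite box_bumpE => b0; apply: zb.
have flat0 (t : R) : flat 1 (n.+1%:R * t) != 0 -> 0 < t.
  by rewrite /flat pmulr_rgt0//; case: ifP => //; rewrite eqxx.
move: b0; rewrite !mulf_eq0 !negb_or -!andbA => /and4P[/flat0 h1 /flat0 h2 /flat0 h3 /flat0 h4].
by split; rewrite /= in_itv/= -subr_gt0 ?h1 ?h3 -subr_gt0 ?h2 ?h4.
Qed.

Lemma cvg_box_bump (R : realType) (p q z : R * R) :
  box_bump n p q z @[n --> \oo] --> (\1_(box p q) z : R).
Proof.
have [zb|zb] := pselect (box p q z); last first.
  rewrite indicE memNset//=; rewrite (_ : (fun n => _) = fun=> 0); first exact: cvg_cst.
  by apply/funext => n; rewrite box_bump_out.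
rewrite indicE mem_set//=.
have [/= ] := zb; rewrite !in_itv/= => /andP[h1 h2] /andP[h3 h4].
rewrite (_ : (fun n => _) = (fun n : nat =>
  (flat 1 (n.+1%:R * (z.1 - p.1)) * flat 1 (n.+1%:R * (q.1 - z.1))) *
  (flat 1 (n.+1%:R * (z.2 - p.2)) * flat 1 (n.+1%:R * (q.2 - z.2))))); last first.
  by apply/funext => n; rewrite box_bumpE.
have -> : 1%:R = (1 * 1) * (1 * 1) :> R by rewrite !mulr1.
by apply: cvgM; apply: cvgM; apply: cvg_flat1; rewrite subr_gt0.
Qed.

Lemma flat_algebra_box_bump (R : realType) n (p q : R * R) : flat_algebra (box_bump n p q).
Proof.
by apply: flat_algebraM; apply: flat_algebraM; exact: flat_algebra_gen.
Qed.

(** The compact companion of [box]: local square integrability speaks of compact sets, while the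
    bumps vanish off the open box. *)
Definition cbox (R : realType) (p q : R * R) : set (R * R) :=
  `[p.1, q.1] `*` `[p.2, q.2].

Lemma compact_cbox (R : realType) (p q : R * R) : compact (cbox p q).
Proof. by apply: compact_setX; exact: segment_compact. Qed.

Lemma box_cbox (R : realType) (p q : R * R) : box p q `<=` cbox p q.
Proof. by move=> z [] /=; split; exact: subset_itv_oo_cc. Qed.

Lemma closed_compact_plane (R : realType) (K : set (R * R)) : compact K -> closed K.
Proof. by apply: compact_closed; exact: norm_hausdorff. Qed.

Lemma test_function_box_bump (R : realType) n (p q : R * R) : test_function (box_bump n p q).
Proof.
split; first exact/smooth_flat_algebra/flat_algebra_box_bump.
apply: (subclosed_compact _ (@compact_cbox _ p q)); first exact: closed_closure.
rewrite closureE; apply: smallest_sub;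
  first by apply: closed_compact_plane; exact: compact_cbox.
move=> z /= bz; apply: box_cbox; apply: contrapT => /(box_bump_out n).
exact/eqP.
Qed.

(** * The fundamental lemma of the calculus of variations *)

(** Both projections are measurable for the sigma-algebra generated by the boxes, because a strip
    over an open interval is the union of the boxes whose other side is []-n, n[]. Hence this
    sigma-algebra contains all measurable rectangles. *)
Lemma measurable_plane_box (R : realType) :
  @measurable _ (@plane R) =
  <<s [set A : set (R * R) | exists p q, A = box p q] >>.
Proof.
set G := [set A | _].
have mbox p q : G.-sigma.-measurable (box p q).
  by apply: sub_sigma_algebra; exists p, q.
have in_oo (t : R) : exists n : nat, t \in `]-(n%:R), n%:R[.
  exists (Num.truncn `|t|).+1; rewrite in_itv/= -ltr_norml.
  exact: truncnS_gt.
have mfst : measurable_fun setT (fst : g_sigma_algebraType G -> measurableTypeR R).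
  apply: (measurability _ (RGenOpens.measurableE R)) => _ [_ [x [y ->]] <-].
  rewrite setTI (_ : _ @^-1` _ = \bigcup_n box (x, - n%:R) (y, n%:R)); last first.
    apply/seteqP; split => [z /= zxy|z [n _] []//].
    by have [n zn] := in_oo z.2; exists n.
  exact: bigcupT_measurable.
have msnd : measurable_fun setT (snd : g_sigma_algebraType G -> measurableTypeR R).
  apply: (measurability _ (RGenOpens.measurableE R)) => _ [_ [x [y ->]] <-].
  rewrite setTI (_ : _ @^-1` _ = \bigcup_n box (- n%:R, x) (n%:R, y)); last first.
    apply/seteqP; split => [z /= zxy|z [n _] []//].
    by have [n zn] := in_oo z.1; exists n.
  exact: bigcupT_measurable.
rewrite eqEsubset; split.
  rewrite measurable_prod_measurableType.
  apply: smallest_sub; first exact: smallest_sigma_algebra.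
  move=> _ [A mA] [B mB] <-.
  have -> : A `*` B = (setT `&` fst @^-1` A) `&` (setT `&` snd @^-1` B) :> set (R * R).
    by rewrite !setTI.
  by apply: (@measurableI _ (g_sigma_algebraType G)); [exact: mfst|exact: msnd].
apply: smallest_sub; first exact: sigma_algebra_measurable.
by move=> _ [p [q ->]]; apply: measurableX; exact: measurable_itv.
Qed.

Lemma measurable_box (R : realType) (p q : R * R) :
  measurable (box p q : set plane).
Proof. by apply: measurableX; exact: measurable_itv. Qed.

Lemma measurable_cbox (R : realType) (p q : R * R) :
  measurable (cbox p q : set plane).
Proof. by apply: measurableX; exact: measurable_itv. Qed.

(** Links the product topology with the product sigma-algebra: an open set is the union of the
    countably many rational boxes that it contains. *)
Lemma open_measurable_plane (R : realType) (U : set (R * R)) :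
  open U -> measurable (U : set plane).
Proof.
move=> oU.
pose rbox (s : (rat * rat) * (rat * rat)) : set (R * R) :=
  box (ratr s.1.1, ratr s.1.2) (ratr s.2.1, ratr s.2.2).
have -> : U = \bigcup_(s in [set s | rbox s `<=` U]) rbox s.
  apply/seteqP; split=> [z Uz|z [s /= sU /sU]//].
  have := open_nbhs_nbhs (conj oU Uz) => /nbhs_ballP[e /= e0 eU].
  have ratP (t : R) : exists ab : rat * rat,
     [/\ t - e < ratr ab.1, ratr ab.1 < t, t < ratr ab.2 & ratr ab.2 < t + e].
    have te : t - e < t by lra.
    have et : t < t + e by lra.
    have [a] := rat_in_itvoo te; have [b] := rat_in_itvoo et.
    rewrite !in_itv/= => /andP[b1 b2] /andP[a1 a2].
    by exists (a, b).
  have [[a b] /= [a1 a2 b1 b2]] := ratP z.1.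
  have [[c d] /= [c1 c2 d1 d2]] := ratP z.2.
  exists ((a, c), (b, d)); rewrite /rbox/=.
    move=> w [] /=; rewrite !in_itv/= => /andP[w1 w2] /andP[w3 w4].
    by apply: eU; split; rewrite /ball/= ltr_distl; lra.
  by split; rewrite /= in_itv/= ?a2 ?b1 ?c2 ?d1.
rewrite bigcup_mkcond; apply: countable_bigcupT_measurable => // s.
by case: ifP => _; [exact: measurable_box|exact: measurable0].
Qed.

Lemma closed_measurable_plane (R : realType) (U : set (R * R)) :
  closed U -> measurable (U : set plane).
Proof.
by move=> /closed_openC/open_measurable_plane/measurableC; rewrite setCK.
Qed.

Lemma compact_measurable_plane (R : realType) (K : set (R * R)) :
  compact K -> measurable (K : set plane).
Proof. by move=> /closed_compact_plane/closed_measurable_plane. Qed.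

Lemma continuous_measurable_plane (R : realType) (f : R * R -> R) :
  continuous f -> measurable_fun setT (f : plane -> measurableTypeR R).
Proof.
move=> /continuousP cf; apply: (measurability _ (RGenOpens.measurableE R)).
move=> _ [_ [a [b ->] <-]]; rewrite setTI; apply: open_measurable_plane.
exact/cf/interval_open.
Qed.

Lemma leb2_cbox_lty (R : realType) (p q : R * R) : (leb2 (cbox p q) < +oo)%E.
Proof.
have -> : leb2 (cbox p q) =
    (lebesgue_measure `[p.1, q.1] * lebesgue_measure `[p.2, q.2])%E.
  by apply: product_measure1E; exact: measurable_itv.
by rewrite /= !lebesgue_measure_itv; case: ifP; case: ifP => _ _;
  rewrite ?mul0e ?mule0// -EFinM ltry.
Qed.

Lemma compact_sub_cbox (R : realType) (K : set (R * R)) : compact K ->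
  exists M : R, K `<=` cbox (- M, - M) (M, M).
Proof.
move=> /compact_bounded [M [_ MK]]; exists (M + 1) => z /(MK (M + 1)).
rewrite ltrDl ltr01 => /(_ isT) /= zM.
have : `|z.1| <= M + 1 /\ `|z.2| <= M + 1.
  by move: zM; rewrite prod_normE ge_max => /andP[].
by rewrite !ler_norml => -[h1 h2]; split; rewrite /= in_itv/=.
Qed.

Lemma leb2_compact_lty (R : realType) (K : set (R * R)) :
  compact K -> (leb2 K < +oo)%E.
Proof.
move=> cK; have [M KM] := compact_sub_cbox cK.
apply: le_lt_trans (leb2_cbox_lty (- M, - M) (M, M)).
apply: le_measure => //; rewrite inE; last exact: measurable_cbox.
exact: compact_measurable_plane.
Qed.

Lemma boxI (R : realType) (p q p' q' : R * R) : box p q `&` box p' q' =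
  box (Num.max p.1 p'.1, Num.max p.2 p'.2) (Num.min q.1 q'.1, Num.min q.2 q'.2).
Proof.
apply/seteqP; split => z.
  move=> [[/=]]; rewrite !in_itv/= => /andP[h1 h2] /andP[h3 h4] [/=].
  rewrite !in_itv/= => /andP[h1' h2'] /andP[h3' h4'].
  by split; rewrite /= in_itv/= gt_max lt_min ?h1 ?h2 ?h3 ?h4 ?h1' ?h2' ?h3' ?h4'.
move=> [/=]; rewrite !in_itv/= !gt_max !lt_min.
move=> /andP[/andP[a b] /andP[c d]] /andP[/andP[a' b'] /andP[c' d']].
by split; split; rewrite /= in_itv/=; apply/andP.
Qed.

(** Dominated convergence on the closed box: the bumps lie between 0 and 1, so [|h|] is a majorant,
    and [h] times the bump tends to [h] times the indicator of the open box. *)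
Lemma integral_box_eq0 (R : realType) (h : R * R -> R) (p q : R * R) :
  leb2.-integrable (cbox p q) (EFin \o h) ->
  (forall n, \int[leb2]_z (h z * box_bump n p q z) = 0) ->
  (\int[leb2]_(z in box p q) (h z)%:E = 0)%E.
Proof.
move=> hi hb; have mh := measurable_int _ hi.
have mbox' := @measurable_box R p q; have mc := @measurable_cbox R p q.
have mbump n : measurable_fun (cbox p q) (box_bump n p q : plane -> R).
  apply: (@measurable_funS _ _ _ _ setT) => //.
  apply: continuous_measurable_plane; apply: continuous_flat_algebra.
  exact: flat_algebra_box_bump.
pose f_ n (z : plane) := (h z * box_bump n p q z)%:E.
pose f (z : plane) := (h z * \1_(box p q) z)%:E.
have [_ _] : [/\ leb2.-integrable (cbox p q) f,
    [sequence (\int[leb2]_(x in cbox p q) `|f_ n x - f x|)%E]_n @ \oo --> 0%E &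
    [sequence (\int[leb2]_(x in cbox p q) f_ n x)%E]_n @ \oo -->
      (\int[leb2]_(x in cbox p q) f x)%E].
  apply: (@dominated_convergence _ _ R leb2 (cbox p q) mc f_ f
    (fun z => `|(h z)%:E|%E)).
  - move=> n; apply/measurable_EFinP; apply: measurable_funM.
      exact/measurable_EFinP.
    exact: mbump.
  - rewrite /f; apply/measurable_EFinP; apply: measurable_funM; first exact/measurable_EFinP.
    by apply: measurable_indic; exact: measurable_box.
  - apply: aeW => z _; apply: cvg_EFin; first by apply: nearW => n.
    by apply: cvgM; [exact: cvg_cst|exact: cvg_box_bump].
  - exact: integrable_abse.
  - apply: aeW => z n _; rewrite /f_ abse_EFin lee_fin normrM ler_piMr//.
    by rewrite ger0_norm ?box_bump_ge0// box_bump_le1.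
have -> : [sequence (\int[leb2]_(x in cbox p q) f_ n x)%E]_n = (fun=> 0%E).
  apply/funext => n /=.
  have fi : leb2.-integrable (cbox p q) (f_ n).
    apply: le_integrable hi => //.
      apply/measurable_EFinP; apply: measurable_funM; first exact/measurable_EFinP.
      exact: mbump.
    move=> z _; rewrite /f_ /= lee_fin normrM ler_piMr//.
    by rewrite ger0_norm ?box_bump_ge0// box_bump_le1.
  (* The integral over the closed box equals the one over the plane, as the bump vanishes
     outside. *)
  rewrite -(fineK (integrable_fin_num mc fi)); congr EFin; rewrite -[RHS](hb n).
  transitivity (\int[leb2]_(z in cbox p q) (h z * box_bump n p q z)) => //.
  rewrite Rintegral_mkcond; apply: eq_Rintegral => z _.
  rewrite patchE; case: ifPn => // /negP; rewrite inE => zc.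
  by rewrite box_bump_out ?mulr0// => /box_cbox.
move=> /(cvg_lim (@ereal_hausdorff R)); rewrite lim_cst// => ->.
have {1}-> : box p q = cbox p q `&` box p q by rewrite setIC; apply/esym/setIidPl/box_cbox.
rewrite integral_mkcondr; apply: eq_integral => z _.
rewrite patchE /f indicE; case: ifP => _; first by rewrite mulr1.
by rewrite mulr0.
Qed.

Lemma box_setI_closed (R : realType) :
  setI_closed [set A : set (R * R) | exists p q, A = box p q].
Proof.
by move=> _ _ [p [q ->]] [p' [q' ->]]; rewrite boxI; do 2 eexists.
Qed.

(** The sets [A] for which [h] has integral 0 over [A] intersected with the box form a Dynkin
    system. It contains the pi-system of boxes, hence all measurable sets, and an integrable
    function with vanishing integrals over all measurable subsets is zero almost everywhere. *)
Lemma ae_eq0_box (R : realType) (h : R * R -> R) (p q : R * R) :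
  leb2.-integrable (cbox p q) (EFin \o h) ->
  (forall p' q', cbox p' q' `<=` cbox p q -> (\int[leb2]_(z in box p' q') (h z)%:E = 0)%E) ->
  {ae leb2, forall z, box p q z -> h z = 0}.
Proof.
move=> hi0 h0; have mbox := @measurable_box R.
have hi : leb2.-integrable (box p q) (EFin \o h).
  by apply: integrableS hi0 => //; [exact: measurable_cbox|exact: box_cbox].
have hiS A : measurable (A : set plane) -> leb2.-integrable (A `&` box p q) (EFin \o h).
  by move=> mA; apply: integrableS hi => //; exact: measurableI.
suff H A : measurable (A : set plane) ->
    (\int[leb2]_(z in A `&` box p q) (h z)%:E = 0)%E.
  have : ae_eq leb2 (box p q) (EFin \o h) (cst 0%E).
    apply: integral_ae_eq => // E Ebox mE; rewrite integral0.
    by rewrite -[RHS](H E mE); congr (integral _ _ _); apply/esym/setIidPl.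
  by apply: filterS => z /= hz /hz [].
move=> mA.
pose P (A : set plane) := (\int[leb2]_(z in A `&` box p q) (h z)%:E = 0)%E.
apply: (@dynkin_induction _ plane _ P (@measurable_plane_box R) (@box_setI_closed R)).
- by rewrite /P setTI h0.
- move=> _ [p' [q' ->]]; rewrite /P boxI h0// => z [/=].
  rewrite !in_itv/= !ge_max !le_min => /andP[/andP[_ a] /andP[_ b]] /andP[/andP[_ c] /andP[_ d]].
  by split; rewrite /= in_itv/=; apply/andP.
- move=> S mS PS; have := h0 p q (@subset_refl _ _).
  have {1}-> : box p q = (S `&` box p q) `|` (~` S `&` box p q).
    by rewrite -setIUl setUv setTI.
  rewrite integral_setU => //=.
  + by rewrite [X in (X + _)%E]PS add0e.
  + exact: measurableI.
  + by apply: measurableI => //; exact: measurableC.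
  + by rewrite -setIUl setUv setTI; exact: measurable_int hi.
  + by apply/disj_setPS => z [[]] Sz _ [].
- move=> F mF tF PF; rewrite /P setI_bigcupl integral_bigcup.
  + by apply: eseries0 => i _ _; exact: PF.
  + exact: trivIset_setIr.
  + by move=> k; exact: measurableI.
  + by rewrite -setI_bigcupl; apply: hiS; exact: bigcupT_measurable.
by rewrite -measurable_plane_box.
Qed.

(** The fundamental lemma, obtained by exhausting the plane with countably many boxes. *)
Lemma test_function_ae_eq0 (R : realType) (h : R * R -> R) :
  (forall p q, leb2.-integrable (cbox p q) (EFin \o h)) ->
  (forall phi, test_function phi -> \int[leb2]_z (h z * phi z) = 0) ->
  {ae leb2, forall z, h z = 0}.
Proof.
move=> hi hphi.
have H (n : nat) : {ae leb2, forall z, box (- n%:R, - n%:R) (n%:R, n%:R) z -> h z = 0}.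
  apply: ae_eq0_box => // p q _; apply: integral_box_eq0 => // n'.
  exact/hphi/test_function_box_bump.
have /ae_foralln := H; apply: filterS => z hz.
apply: (hz (Num.truncn `|z|).+1); have := truncnS_gt `|z|.
by rewrite prod_normE gt_max !ltr_norml => /andP[]; split; rewrite /= in_itv.
Qed.

(** * Complex-valued square-integrable functions *)

Lemma normc_sqr (R : rcfType) (z : R[i]) :
  Normc.normc z ^+ 2 = complex.Re z ^+ 2 + complex.Im z ^+ 2.
Proof. by case: z => a b; rewrite /= sqr_sqrtr// addr_ge0 ?sqr_ge0. Qed.

Lemma complex_ReM (R : rcfType) (z w : R[i]) :
  complex.Re (z * w) = complex.Re z * complex.Re w - complex.Im z * complex.Im w.
Proof. by case: z w => [a b] [c d]. Qed.

Lemma complex_ImM (R : rcfType) (z w : R[i]) :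
  complex.Im (z * w) = complex.Re z * complex.Im w + complex.Im z * complex.Re w.
Proof. by case: z w => [a b] [c d]. Qed.

Lemma complex_ReD (R : rcfType) (z w : R[i]) :
  complex.Re (z + w) = complex.Re z + complex.Re w.
Proof. by case: z w => [a b] [c d]. Qed.

Lemma complex_ImD (R : rcfType) (z w : R[i]) :
  complex.Im (z + w) = complex.Im z + complex.Im w.
Proof. by case: z w => [a b] [c d]. Qed.

Lemma Re_conjc (R : rcfType) (z : R[i]) : complex.Re (conjc z) = complex.Re z.
Proof. by case: z. Qed.

Lemma Im_conjc (R : rcfType) (z : R[i]) : complex.Im (conjc z) = - complex.Im z.
Proof. by case: z. Qed.

Lemma complex_eqP (R : rcfType) (z w : R[i]) :
  complex.Re z = complex.Re w -> complex.Im z = complex.Im w -> z = w.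
Proof. by case: z w => [a b] [c d] /= -> ->. Qed.

(** By the parallelogram identity the two sides differ by [|c z - w|^2]. *)
Lemma normc_comb_le (R : rcfType) (c z w : R[i]) :
  Normc.normc (c * z + w) ^+ 2 <=
  2 * Normc.normc c ^+ 2 * Normc.normc z ^+ 2 + 2 * Normc.normc w ^+ 2.
Proof.
case: c z w => [a b] [p q] [s t]; rewrite !normc_sqr /= -subr_ge0.
rewrite (_ : _ - _ = (a * p - b * q - s) ^+ 2 + (a * q + b * p - t) ^+ 2); last by ring.
by rewrite addr_ge0 ?sqr_ge0.
Qed.

(** Provides the integrable majorant [|f|^2 + |g|^2] for the real and imaginary parts of
    [f * conj g]. *)
Lemma norm_dot_le (R : realDomainType) (p q s t : R) :
  `|p * s + q * t| <= p ^+ 2 + q ^+ 2 + (s ^+ 2 + t ^+ 2).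
Proof.
have := sqr_ge0 (p + s); have := sqr_ge0 (p - s).
have := sqr_ge0 (q + t); have := sqr_ge0 (q - t).
have := sqr_ge0 p; have := sqr_ge0 q; have := sqr_ge0 s; have := sqr_ge0 t.
by rewrite ler_norml => *; apply/andP; split; nra.
Qed.

Definition cintegrable (R : realType) (D : set (R * R)) (f : cfun) : Prop :=
  leb2.-integrable D (fun x : plane => (complex.Re (f x))%:E) /\
  leb2.-integrable D (fun x : plane => (complex.Im (f x))%:E).

Definition cmeasurable (R : realType) (D : set (R * R)) (f : cfun) : Prop :=
  measurable_fun (D : set plane) (fun x : plane => complex.Re (f x)) /\
  measurable_fun (D : set plane) (fun x : plane => complex.Im (f x)).

Section fixed_domain.
Context {R : realType} {D : set (R * R)} (mD : measurable (D : set plane)).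
Implicit Types f g : @cfun R.

Lemma cmeasurable_comb (c : R[i]) f g :
  cmeasurable D f -> cmeasurable D g -> cmeasurable D (fun x => c * f x + g x).
Proof.
move=> [f1 f2] [g1 g2]; split.
  rewrite (_ : (fun x => _) = fun x : plane => complex.Re c * complex.Re (f x) -
      complex.Im c * complex.Im (f x) + complex.Re (g x)); last first.
    by apply/funext => x; rewrite complex_ReD complex_ReM.
  by apply: measurable_funD => //; apply: measurable_funB; apply: measurable_funM.
rewrite (_ : (fun x => _) = fun x : plane => complex.Re c * complex.Im (f x) +
    complex.Im c * complex.Re (f x) + complex.Im (g x)); last first.
  by apply/funext => x; rewrite complex_ImD complex_ImM.
by apply: measurable_funD => //; apply: measurable_funD; apply: measurable_funM.
Qed.

Lemma cmeasurable_normc_sqr f : cmeasurable D f ->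
  measurable_fun (D : set plane) (fun x : plane => Normc.normc (f x) ^+ 2).
Proof.
move=> [f1 f2].
rewrite (_ : (fun x => _) = fun x : plane => complex.Re (f x) ^+ 2 +
    complex.Im (f x) ^+ 2); last by apply/funext => x; rewrite normc_sqr.
by apply: measurable_funD; apply: measurable_funX.
Qed.

(** Translates the finiteness condition in [L2] into the integrability predicate on which the
    integral lemmas rest. *)
Lemma L2P f : L2 D f <-> cmeasurable D f /\
  leb2.-integrable D (fun x : plane => (Normc.normc (f x) ^+ 2)%:E).
Proof.
split=> [[f1 f2 fi]|[[f1 f2] /integrableP[mf fi]]].
  have mf : cmeasurable D f by [].
  split => //; apply/integrableP; split.
    by apply/measurable_EFinP; exact: cmeasurable_normc_sqr.
  apply: le_lt_trans fi; rewrite le_eqVlt; apply/orP; left; apply/eqP.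
  by apply: eq_integral => x _; rewrite abse_EFin ger0_norm// sqr_ge0.
split => //; apply: le_lt_trans fi; rewrite le_eqVlt; apply/orP; left; apply/eqP.
by apply: eq_integral => x _; rewrite abse_EFin ger0_norm// sqr_ge0.
Qed.

Lemma le_Rintegrable (f g : R * R -> R) :
  measurable_fun (D : set plane) (f : plane -> R) ->
  leb2.-integrable D (EFin \o g) -> (forall x, `|f x| <= g x) ->
  leb2.-integrable D (EFin \o f).
Proof.
move=> mf gi fg; apply: le_integrable gi => //; first exact/measurable_EFinP.
by move=> x _; rewrite /= lee_fin (le_trans (fg x)) ?ler_norm.
Qed.

Lemma integrable_comb (a b : R) (f g : R * R -> R) :
  leb2.-integrable D (EFin \o f) -> leb2.-integrable D (EFin \o g) ->
  leb2.-integrable D (EFin \o (fun x => a * f x + b * g x)).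
Proof.
move=> fi gi.
have := integrableD mD (integrableZl mD a fi) (integrableZl mD b gi).
by apply: eq_integrable.
Qed.

Lemma L2_comb (c : R[i]) f g : L2 D f -> L2 D g -> L2 D (fun x => c * f x + g x).
Proof.
move=> /L2P[mf fi] /L2P[mg gi]; apply/L2P.
have m := cmeasurable_comb c mf mg; split => //.
apply: (@le_Rintegrable _
  (fun x => 2 * Normc.normc c ^+ 2 * Normc.normc (f x) ^+ 2 +
            2 * Normc.normc (g x) ^+ 2)).
- exact: cmeasurable_normc_sqr.
- exact: integrable_comb.
by move=> x; rewrite ger0_norm ?sqr_ge0// normc_comb_le.
Qed.

Lemma L2_cintegrable_mul f g : L2 D f -> L2 D g ->
  cintegrable D (fun x => f x * conjc (g x)).
Proof.
move=> /L2P[[f1 f2] fi] /L2P[[g1 g2] gi].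
have ni := integrable_comb 1 1 fi gi; split.
- apply: le_Rintegrable ni _.
    rewrite (_ : (fun x => _) = fun x : plane => complex.Re (f x) * complex.Re (g x) +
        complex.Im (f x) * complex.Im (g x)); last first.
      by apply/funext => x; rewrite complex_ReM Re_conjc Im_conjc mulrN opprK.
    by apply: measurable_funD; apply: measurable_funM.
  move=> x; rewrite !mul1r !normc_sqr complex_ReM Re_conjc Im_conjc mulrN opprK.
  exact: norm_dot_le.
- apply: le_Rintegrable ni _.
    rewrite (_ : (fun x => _) = fun x : plane => complex.Im (f x) * complex.Re (g x) -
        complex.Re (f x) * complex.Im (g x)); last first.
      by apply/funext => x; rewrite complex_ImM Re_conjc Im_conjc mulrN addrC.
    by apply: measurable_funB; apply: measurable_funM.
  move=> x; rewrite !mul1r !normc_sqr complex_ImM Re_conjc Im_conjc.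
  by rewrite (addrC (complex.Re (g x) ^+ 2)) -(sqrrN (complex.Im (g x))) norm_dot_le.
Qed.

Lemma eq_cintegral f g : (forall x, D x -> f x = g x) ->
  cintegral D f = cintegral D g.
Proof.
move=> fg; rewrite /cintegral; congr (_ +i* _); apply: eq_Rintegral => x;
  by rewrite inE => /fg ->.
Qed.

Lemma cintegral_comb (c : R[i]) f g : cintegrable D f -> cintegrable D g ->
  cintegral D (fun x => c * f x + g x) = c * cintegral D f + cintegral D g.
Proof.
move=> [f1 f2] [g1 g2].
have comb (a b : R) (u v w : plane -> R) :
    leb2.-integrable D (EFin \o u) -> leb2.-integrable D (EFin \o v) ->
    leb2.-integrable D (EFin \o w) ->
    \int[leb2]_(x in D) (a * u x + b * v x + w x) =
    a * (\int[leb2]_(x in D) u x) + b * (\int[leb2]_(x in D) v x) + \int[leb2]_(x in D) w x.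
  move=> ui vi wi; rewrite RintegralD//; last exact: (integrable_comb a b).
  rewrite RintegralD//; [|exact: (integrableZl mD a ui)|exact: (integrableZl mD b vi)].
  by rewrite !RintegralZl.
apply: complex_eqP; rewrite /cintegral /=.
  under eq_Rintegral do rewrite complex_ReD complex_ReM -mulNr.
  by rewrite comb// complex_ReD complex_ReM/= mulNr.
under eq_Rintegral do rewrite complex_ImD complex_ImM.
by rewrite comb// complex_ImD complex_ImM/=.
Qed.

Lemma cintegral_conj f : cintegrable D f ->
  cintegral D (fun x => conjc (f x)) = conjc (cintegral D f).
Proof.
move=> [f1 f2]; apply: complex_eqP; rewrite ?Re_conjc ?Im_conjc /cintegral/=.
  by under eq_Rintegral do rewrite Re_conjc.
under eq_Rintegral do rewrite Im_conjc -mulN1r.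
by rewrite RintegralZl// mulN1r.
Qed.

Lemma ae_eq_cintegral f g : cmeasurable D f -> cmeasurable D g ->
  {ae leb2, forall x : plane, D x -> f x = g x} -> cintegral D f = cintegral D g.
Proof.
move=> [f1 f2] [g1 g2] fg; rewrite /cintegral /Rintegral.
congr (fine _ +i* fine _); apply: ae_eq_integral => //;
  by [exact/measurable_EFinP | apply: filterS fg => x fgx Dx; rewrite fgx].
Qed.

End fixed_domain.

(** * Weak derivatives *)

Lemma L2_subset (R : realType) (D E : set (R * R)) (f : cfun) :
  measurable (D : set plane) -> measurable (E : set plane) -> E `<=` D ->
  L2 D f -> L2 E f.
Proof.
move=> mD mE ED /L2P[[f1 f2] fi]; apply/L2P; split.
  by split; apply: measurable_funS ED _.
exact: integrableS fi.
Qed.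

Lemma L2loc_comb (R : realType) (c : R[i]) (f g : cfun) :
  L2loc f -> L2loc g -> L2loc (fun x => c * f x + g x).
Proof.
move=> fl gl K cK; apply: L2_comb; [exact: compact_measurable_plane|exact: fl|exact: gl].
Qed.

Lemma continuous_L2loc (R : realType) (psi : R * R -> R) :
  continuous psi -> L2loc (fun x => (psi x)%:C : R[i]).
Proof.
move=> cpsi K cK; have mK := compact_measurable_plane cK.
have m : measurable_fun (K : set plane) (psi : plane -> R).
  by apply: (@measurable_funS _ _ _ _ setT) => //; exact: continuous_measurable_plane.
apply/L2P; split; first by split; [exact: m|exact: measurable_cst].
under eq_fun do rewrite normc_sqr /= expr0n addr0.
apply: (@measurable_bounded_integrable _ _ _ leb2 (fun x => psi x ^+ 2) K mK).
- exact: leb2_compact_lty.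
- exact: measurable_funX.
have : compact ((fun x => psi x ^+ 2) @` K).
  apply: continuous_compact => //; apply: continuous_subspaceT => x.
  by apply: (@continuous_comp _ _ _ psi (fun t => t ^+ 2)); [exact: cpsi|exact: exprn_continuous].
move=> /compact_bounded[M [Mr HM]]; exists M; split => // N /HM h x Kx.
by apply: h; exists x.
Qed.

(** On [K] this is a product of two square-integrable functions, [psi] being real and thus its own
    conjugate; outside [K] the product is zero. *)
Lemma cintegrable_mul_test (R : realType) (u : cfun) (psi : R * R -> R)
    (K : set (R * R)) :
  L2loc u -> continuous psi -> compact K -> (forall x, ~ K x -> psi x = 0) ->
  cintegrable setT (fun x => u x * (psi x)%:C).
Proof.
move=> ul cpsi cK psi0; have mK := compact_measurable_plane cK.
have [i1 i2] := L2_cintegrable_mul mK (ul _ cK) (continuous_L2loc cpsi cK).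
have conjR (t : R) : conjc (t%:C : R[i]) = t%:C by apply/eqP; rewrite eq_complex /= oppr0 !eqxx.
split.
  move: i1 => /(integrable_mkcond _ mK); apply: eq_integrable => // x _.
  rewrite patchE conjR; case: ifPn => // /negP; rewrite inE => /psi0 ->.
  by rewrite complex_ReM /= !mulr0 subr0.
move: i2 => /(integrable_mkcond _ mK); apply: eq_integrable => // x _.
rewrite patchE conjR; case: ifPn => // /negP; rewrite inE => /psi0 ->.
by rewrite complex_ImM /= !mulr0 addr0.
Qed.

Lemma test_function_continuous (R : realType) (phi : R * R -> R) :
  test_function phi -> continuous phi.
Proof. by move=> [/(_ [::])[]]. Qed.

Lemma test_function_eq0 (R : realType) (phi : R * R -> R) x :
  ~ closure [set x | phi x != 0] x -> phi x = 0.
Proof.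
by move=> h; apply/eqP/negPn/negP => /= phix; apply: h; exact: subset_closure.
Qed.

Lemma test_function_derive_continuous (R : realType) (phi : R * R -> R) j :
  test_function phi -> continuous (fun x => 'D_(unit_vec j) phi x).
Proof. by move=> [/(_ [:: j])[]]. Qed.

Lemma test_function_derive_eq0 (R : realType) (phi : R * R -> R) j x :
  ~ closure [set x | phi x != 0] x -> 'D_(unit_vec j) phi x = 0.
Proof.
(* The complement of the support is open, so [phi] vanishes in a whole neighbourhood of [x]. *)
move=> phix; rewrite (@near_eq_derive _ _ _ phi (cst 0)) ?derive_cst//.
have : nbhs x (~` closure [set x | phi x != 0]).
  by apply: open_nbhs_nbhs; split => //; exact/closed_openC/closed_closure.
by apply: filterS => y /test_function_eq0.
Qed.

Lemma is_weak_partial_comb (R : realType) (j : 'I_2) (c : R[i]) (u v g h : cfun) :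
  L2loc u -> L2loc v -> is_weak_partial j u g -> is_weak_partial j v h ->
  is_weak_partial j (fun x => c * u x + v x) (fun x => c * g x + h x).
Proof.
move=> ul vl [gl ug] [hl vh]; split; first exact: L2loc_comb.
move=> phi tphi.
have ci w : L2loc w -> cintegrable setT (fun x => w x * (phi x)%:C).
  move=> wl; apply: cintegrable_mul_test wl _ (proj2 tphi) _.
    exact: test_function_continuous.
  by move=> x; exact: test_function_eq0.
have ci' w : L2loc w -> cintegrable setT (fun x => w x * ('D_(unit_vec j) phi x)%:C).
  move=> wl; apply: cintegrable_mul_test wl _ (proj2 tphi) _.
    exact: test_function_derive_continuous.
  by move=> x; exact: test_function_derive_eq0.
under eq_fun do rewrite mulrDl -mulrA.
rewrite (cintegral_comb measurableT _ (ci' _ ul) (ci' _ vl)).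
under [in RHS]eq_fun do rewrite mulrDl -mulrA.
rewrite (cintegral_comb measurableT _ (ci _ gl) (ci _ hl)).
by rewrite ug// vh// opprD mulrN.
Qed.

(** Multiplication by the constant 1, itself square-integrable on the box, turns square
    integrability into integrability. *)
Lemma L2_integrable_cbox (R : realType) (f : cfun) (p q : R * R) :
  L2loc f -> cintegrable (cbox p q) f.
Proof.
move=> fl; have c := @compact_cbox R p q.
have m1 : L2loc (fun x => (cst (1 : R) x)%:C : R[i]).
  by apply: continuous_L2loc => x; exact: cvg_cst.
have := L2_cintegrable_mul (measurable_cbox p q) (fl _ c) (m1 _ c).
rewrite (_ : (fun x => _) = f)//; apply/funext => x.
rewrite (_ : conjc _ = 1) ?mulr1//; apply/eqP.
by rewrite eq_complex /= oppr0 !eqxx.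
Qed.

(** The difference [-1 * h + g] integrates to 0 against every test function; the fundamental lemma
    is applied to its real and imaginary parts separately. *)
Lemma is_weak_partial_unique (R : realType) (j : 'I_2) (u g h : @cfun R) :
  is_weak_partial j u g -> is_weak_partial j u h ->
  {ae leb2, forall x : plane, g x = h x}.
Proof.
move=> [gl ug] [hl uh].
have dl := L2loc_comb (-1) hl gl.
have d0 phi : test_function phi -> cintegral setT (fun x => (-1 * h x + g x) * (phi x)%:C) = 0.
  move=> tphi.
  have ci w : L2loc w -> cintegrable setT (fun x => w x * (phi x)%:C).
    move=> wl; apply: cintegrable_mul_test wl _ (proj2 tphi) _.
      exact: test_function_continuous.
    by move=> x; exact: test_function_eq0.
  under eq_fun do rewrite mulrDl -mulrA.
  rewrite (cintegral_comb measurableT _ (ci _ hl) (ci _ gl))//.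
  by rewrite mulN1r -uh// ug// addNr.
have reD0 : {ae leb2, forall x : plane, complex.Re (-1 * h x + g x) = 0}.
  apply: (@test_function_ae_eq0 R (fun x => complex.Re (-1 * h x + g x))).
    by move=> p q; case: (L2_integrable_cbox p q dl).
  move=> phi /d0 /(congr1 (@complex.Re R)) /= <-.
  by apply: eq_Rintegral => x _; rewrite complex_ReM/= mulr0 subr0.
have imD0 : {ae leb2, forall x : plane, complex.Im (-1 * h x + g x) = 0}.
  apply: (@test_function_ae_eq0 R (fun x => complex.Im (-1 * h x + g x))).
    by move=> p q; case: (L2_integrable_cbox p q dl).
  move=> phi /d0 /(congr1 (@complex.Im R)) /= <-.
  by apply: eq_Rintegral => x _; rewrite complex_ImM/= mulr0 add0r.
apply: filterS2 reD0 imD0 => x rx ix.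
apply/eqP; rewrite -subr_eq0 -mulN1r addrC; apply/eqP.
by apply: complex_eqP; [exact: rx|exact: ix].
Qed.

Lemma weak_partialP (R : realType) (j : 'I_2) (u : @cfun R) :
  H1loc u -> is_weak_partial j u (weak_partial j u).
Proof. by move=> [_ /(_ j)]; exact: xgetPex. Qed.

(** The combination of the chosen representatives is a weak derivative of the combination, so by
    uniqueness it agrees almost everywhere with the representative chosen there. *)
Lemma weak_partial_comb (R : realType) (j : 'I_2) (c : R[i]) (u v : @cfun R) :
  H1loc u -> H1loc v -> {ae leb2, forall x : plane,
    weak_partial j (fun x => c * u x + v x) x =
    c * weak_partial j u x + weak_partial j v x}.
Proof.
move=> hu hv.
have w i : is_weak_partial i (fun x => c * u x + v x)
    (fun x => c * weak_partial i u x + weak_partial i v x).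
  by apply: is_weak_partial_comb; [exact: hu.1|exact: hv.1|exact: weak_partialP..].
apply: is_weak_partial_unique (w j); apply: weak_partialP; split.
  by apply: L2loc_comb; [exact: hu.1|exact: hv.1].
by move=> i; eexists; exact: w.
Qed.

(** * Pairings of bounded maps into [L2] *)

Definition sqnorm (R : realType) (D : set (R * R)) (f : cfun) : R :=
  \int[leb2]_(x in D) (Normc.normc (f x) ^+ 2).

Lemma sqnorm_ge0 (R : realType) (D : set (R * R)) (f : cfun) : 0 <= sqnorm D f.
Proof. by apply: Rintegral_ge0 => x _; exact: sqr_ge0. Qed.

Lemma discriminant_le0 (R : realFieldType) (a b c : R) : 0 <= a -> 0 <= c ->
  (forall s t, 0 <= s ^+ 2 * a + 2 * (s * t) * b + t ^+ 2 * c) -> b ^+ 2 <= a * c.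
Proof.
move=> a0 c0 H; have [c_gt0|] := ltrP 0 c.
  (* For [c > 0] this choice gives [c (a c - b^2) >= 0]. *)
  have := H c (- b).
  have -> : c ^+ 2 * a + 2 * (c * - b) * b + (- b) ^+ 2 * c = c * (a * c - b ^+ 2).
    by ring.
  by rewrite pmulr_rge0// subr_ge0.
move=> c_le0; have c_eq0 : c = 0 by apply/le_anti/andP.
(* For [c = 0] the second argument is chosen so that the form becomes [-(b^2 (a + 2))], which forces
   [b^2 <= 0]. *)
have := H b (- (a + 1)); rewrite c_eq0 !mulr0 addr0.
have -> : b ^+ 2 * a + 2 * (b * - (a + 1)) * b = - (b ^+ 2 * (a + 2)) by ring.
rewrite oppr_ge0 pmulr_lle0//; lra.
Qed.

Section square_norm.
Context {R : realType} {D : set (R * R)} (mD : measurable (D : set plane)).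
Implicit Types f g : @cfun R.

Lemma L2_scale (c : R[i]) f : L2 D f -> L2 D (fun x => c * f x).
Proof.
(* Scaling is an instance of linear combination through [c f = (c - 1) f + f]. *)
move=> lf; have := L2_comb mD (c - 1) lf lf.
rewrite (_ : (fun x => _) = (fun x => c * f x))//.
by apply/funext => x; rewrite mulrBl mul1r subrK.
Qed.

Lemma cintegral_scale (c : R[i]) f : cintegrable D f ->
  cintegral D (fun x => c * f x) = c * cintegral D f.
Proof.
move=> fi; transitivity (cintegral D (fun x => (c - 1) * f x + f x)).
  by apply: eq_cintegral => x _; rewrite mulrBl mul1r subrK.
by rewrite cintegral_comb// mulrBl mul1r subrK.
Qed.

Lemma sqnorm_scale (c : R[i]) f : L2 D f ->
  sqnorm D (fun x => c * f x) = Normc.normc c ^+ 2 * sqnorm D f.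
Proof.
move=> /L2P[_ fi]; rewrite /sqnorm -RintegralZl//.
by apply: eq_Rintegral => x _; rewrite Normc.normcM exprMn.
Qed.

Lemma sqnorm_comb (s t : R) f g : L2 D f -> L2 D g ->
  sqnorm D (fun x => s%:C * f x + t%:C * g x) =
  s ^+ 2 * sqnorm D f +
  2 * (s * t) * complex.Re (cintegral D (fun x => f x * conjc (g x))) +
  t ^+ 2 * sqnorm D g.
Proof.
move=> lf lg; have [_ fi] := (L2P f).1 lf; have [_ gi] := (L2P g).1 lg.
have [fgi _] := L2_cintegrable_mul mD lf lg.
have fgi' := integrable_comb mD (s ^+ 2) (2 * (s * t)) fi fgi.
rewrite /sqnorm /cintegral/= -!RintegralZl// -RintegralD//; last 2 first.
- exact: (integrableZl mD _ fi).
- exact: (integrableZl mD _ fgi).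
rewrite -RintegralD//; last exact: (integrableZl mD _ gi).
apply: eq_Rintegral => x _;
rewrite !normc_sqr !complex_ReD !complex_ImD !complex_ReM !complex_ImM /=.
rewrite Re_conjc Im_conjc.
ring.
Qed.

(** Cauchy-Schwarz, from the discriminant of the nonnegative quadratic form in [s] and [t] given by
    the squared norm of [s f + t g]. Its cross term only sees the real part of the pairing. *)
Lemma cintegral_normc_le f g : L2 D f -> L2 D g ->
  Normc.normc (cintegral D (fun x => f x * conjc (g x))) <=
  Num.sqrt (sqnorm D f) * Num.sqrt (sqnorm D g).
Proof.
move=> lf lg; set S := cintegral _ _; set A := sqnorm D f; set B := sqnorm D g.
have A0 : 0 <= A := sqnorm_ge0 _ _; have B0 : 0 <= B := sqnorm_ge0 _ _.
have nS : 0 <= Normc.normc S by case: (S) => a b; rewrite sqrtr_ge0.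
rewrite -sqrtrM// -[leLHS]ger0_norm// -sqrtr_sqr ler_wsqrtr//.
have lSf := L2_scale (conjc S) lf.
(* Multiplying [f] by [conj S] makes the pairing real, equal to [|S|^2]. *)
have SE : complex.Re (cintegral D (fun x => conjc S * f x * conjc (g x))) =
    Normc.normc S ^+ 2.
  under eq_fun do rewrite -mulrA.
  rewrite cintegral_scale; last exact: L2_cintegrable_mul.
  by rewrite -/S complex_ReM Re_conjc Im_conjc normc_sqr; ring.
have : (Normc.normc S ^+ 2) ^+ 2 <= (Normc.normc S ^+ 2 * A) * B.
  have -> : Normc.normc S ^+ 2 * A = sqnorm D (fun x => conjc S * f x).
    by rewrite sqnorm_scale// !normc_sqr Re_conjc Im_conjc sqrrN.
  rewrite -[in leLHS]SE; apply: discriminant_le0; rewrite ?sqnorm_ge0// => s t.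
  by rewrite -sqnorm_comb// sqnorm_ge0.
have [->|S0] := eqVneq (Normc.normc S) 0.
  by rewrite expr0n/= => _; rewrite mulr_ge0.
by rewrite expr2 -mulrA ler_pM2l// exprn_gt0// lt_neqAle eq_sym S0.
Qed.

End square_norm.

Section form_calculus.
Context {R : realType} {E : lmodType R[i]} {S : set E} {nrm : E -> R}.
Hypothesis S_comb : forall (c : R[i]) z1 z2, S z1 -> S z2 -> S (c *: z1 + z2).
Implicit Types a b : E -> E -> R[i].

(** The two properties are bundled so that each closure rule below establishes both at once. *)
Definition continuous_sesquilinear a : Prop :=
  sesquilinear_on S a /\ continuous_form_on S a nrm.

(** Agreement on [S] suffices because [S] is stable under combinations. The form is a sum of
    pairings only on its domain, where the integrals may be split. *)
Lemma continuous_sesquilinear_ext a b :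
  (forall z1 z2, S z1 -> S z2 -> a z1 z2 = b z1 z2) ->
  continuous_sesquilinear b -> continuous_sesquilinear a.
Proof.
move=> ab [[b1 b2] [C bC]]; split; last first.
  by exists C => z1 z2 S1 S2; rewrite ab//; exact: bC.
split=> [c z1 z2 z S1 S2 Sz|c z z1 z2 Sz S1 S2].
  by rewrite !ab ?b1//; exact: S_comb.
by rewrite !ab ?b2//; exact: S_comb.
Qed.

Lemma continuous_sesquilinear0 : continuous_sesquilinear (fun _ _ => 0).
Proof.
split; first by split=> *; rewrite mulr0 addr0.
by exists 0 => z1 z2 _ _; rewrite !mul0r Normc.normc0.
Qed.

Lemma continuous_sesquilinearD a b :
  continuous_sesquilinear a -> continuous_sesquilinear b ->
  continuous_sesquilinear (fun z1 z2 => a z1 z2 + b z1 z2).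
Proof.
move=> [[a1 a2] [C aC]] [[b1 b2] [D bD]]; split.
  split=> [c z1 z2 z S1 S2 Sz|c z z1 z2 Sz S1 S2].
    by rewrite a1// b1// mulrDr addrACA.
  by rewrite a2// b2// mulrDr addrACA.
exists (C + D) => z1 z2 S1 S2; rewrite !mulrDl.
by rewrite (le_trans (le_normcD _ _))// lerD ?aC ?bD.
Qed.

Lemma continuous_sesquilinearZ (t : R[i]) a :
  continuous_sesquilinear a -> continuous_sesquilinear (fun z1 z2 => t * a z1 z2).
Proof.
move=> [[a1 a2] [C aC]]; split.
  split=> [c z1 z2 z S1 S2 Sz|c z z1 z2 Sz S1 S2].
    by rewrite a1// mulrDr mulrCA.
  by rewrite a2// mulrDr mulrCA.
exists (Normc.normc t * C) => z1 z2 S1 S2; rewrite Normc.normcM -!mulrA.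
by rewrite ler_wpM2l ?mulrA ?aC//; case: (t) => p q; rewrite sqrtr_ge0.
Qed.

Lemma continuous_sesquilinearN a :
  continuous_sesquilinear a -> continuous_sesquilinear (fun z1 z2 => - a z1 z2).
Proof.
move=> /(continuous_sesquilinearZ (-1)); apply: continuous_sesquilinear_ext.
by move=> z1 z2 _ _; rewrite mulN1r.
Qed.

Lemma continuous_sesquilinear_sum n (a : 'I_n -> E -> E -> R[i]) :
  (forall i, continuous_sesquilinear (a i)) ->
  continuous_sesquilinear (fun z1 z2 => \sum_(i < n) a i z1 z2).
Proof.
elim: n a => [|n IH] a ai.
  apply: continuous_sesquilinear_ext continuous_sesquilinear0.
  by move=> z1 z2 _ _; rewrite big_ord0.
apply: (continuous_sesquilinear_ext (b := fun z1 z2 =>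
  \sum_(i < n) a (widen_ord (leqnSn n) i) z1 z2 + a ord_max z1 z2)).
  by move=> z1 z2 _ _; rewrite big_ord_recr.
by apply: continuous_sesquilinearD => //; exact: IH.
Qed.

(** The exceptional null set may depend on [c], [z1] and [z2]; this is harmless since the integrals
    are compared for one such triple at a time. *)
Definition bounded_map (D : set (R * R)) (P : E -> cfun) : Prop :=
  [/\ forall z, S z -> L2 D (P z),
      forall (c : R[i]) z1 z2, S z1 -> S z2 -> {ae leb2, forall x : plane, D x ->
        P (c *: z1 + z2) x = c * P z1 x + P z2 x} &
      exists K, forall z, S z -> Num.sqrt (sqnorm D (P z)) <= K * nrm z].

Definition pairing (D : set (R * R)) (P Q : E -> cfun) (z1 z2 : E) : R[i] :=
  cintegral D (fun x => P z1 x * conjc (Q z2 x)).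

Lemma cintegrable_cmeasurable (D : set (R * R)) (f : cfun) :
  cintegrable D f -> cmeasurable D f.
Proof.
by move=> [/measurable_int f1 /measurable_int f2]; split; exact/measurable_EFinP.
Qed.

Lemma continuous_sesquilinear_pairing (D : set (R * R)) (P Q : E -> cfun) :
  measurable (D : set plane) -> bounded_map D P -> bounded_map D Q ->
  continuous_sesquilinear (pairing D P Q).
Proof.
move=> mD [lP linP [K HK]] [lQ linQ [M HM]]; split; last first.
  exists (K * M) => z1 z2 S1 S2.
  rewrite (le_trans (cintegral_normc_le mD (lP _ S1) (lQ _ S2)))//.
  rewrite (mulrAC K) -(mulrA (K * _)).
  by rewrite ler_pM ?sqrtr_ge0// ?HK// HM.
have ci z1 z2 : S z1 -> S z2 -> cintegrable D (fun x => P z1 x * conjc (Q z2 x)).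
  by move=> S1 S2; apply: L2_cintegrable_mul => //; [exact: lP|exact: lQ].
split=> [c z1 z2 z S1 S2 Sz|c z z1 z2 Sz S1 S2].
  rewrite /pairing -cintegral_comb//; [|exact: ci..].
  apply: ae_eq_cintegral => //.
  - by apply: cintegrable_cmeasurable; apply: ci => //; exact: S_comb.
  - by apply: cmeasurable_comb; apply: cintegrable_cmeasurable; exact: ci.
  have := linP c _ _ S1 S2; apply: filterS => x h Dx.
  by rewrite h// mulrDl mulrA.
rewrite /pairing -cintegral_comb//; [|exact: ci..].
apply: ae_eq_cintegral => //.
- by apply: cintegrable_cmeasurable; apply: ci => //; exact: S_comb.
- by apply: cmeasurable_comb; apply: cintegrable_cmeasurable; exact: ci.
have := linQ c _ _ S1 S2; apply: filterS => x h Dx.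
by rewrite h// rmorphD rmorphM mulrDr mulrCA.
Qed.

Lemma pairing_conj (D : set (R * R)) (P Q : E -> cfun) z1 z2 :
  measurable (D : set plane) -> bounded_map D P -> bounded_map D Q ->
  S z1 -> S z2 -> pairing D P Q z1 z2 = conjc (pairing D Q P z2 z1).
Proof.
move=> mD [lP _ _] [lQ _ _] S1 S2.
rewrite /pairing -cintegral_conj//; last by apply: L2_cintegrable_mul => //; [exact: lQ|exact: lP].
by apply: eq_cintegral => x _; rewrite rmorphM /= conjcK mulrC.
Qed.

End form_calculus.

Lemma sqnorm_comb_le (R : realType) (D : set (R * R)) (c : R[i]) (f g : cfun) :
  measurable (D : set plane) -> L2 D f -> L2 D g ->
  sqnorm D (fun x => c * f x + g x) <=
  2 * Normc.normc c ^+ 2 * sqnorm D f + 2 * sqnorm D g.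
Proof.
move=> mD lf lg; have [_ fi] := (L2P f).1 lf; have [_ gi] := (L2P g).1 lg.
have [_ hi] := (L2P _).1 (L2_comb mD c lf lg).
rewrite /sqnorm -!RintegralZl// -RintegralD//; last 2 first.
- exact: (integrableZl mD _ fi).
- exact: (integrableZl mD _ gi).
apply: le_Rintegral => //; first exact: (integrable_comb mD _ _ fi gi).
by move=> x _; exact: normc_comb_le.
Qed.

Lemma sqnorm_subset (R : realType) (D E : set (R * R)) (f : cfun) :
  measurable (D : set plane) -> measurable (E : set plane) -> E `<=` D ->
  L2 D f -> sqnorm E f <= sqnorm D f.
Proof.
move=> mD mE ED lf; have [_ fi] := (L2P f).1 lf.
have mDE : measurable (D `\` E : set plane) by exact: measurableD.
rewrite -(setDUK ED) /sqnorm Rintegral_setU//; last 2 first.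
- by rewrite setDUK.
- by apply/disj_setPS => x [Ex [_]].
by rewrite lerDl Rintegral_ge0// => x _; exact: sqr_ge0.
Qed.

Lemma sqnorm_decomposition (R : realType) (D D1 D2 : set (R * R)) (f : cfun) :
  measurable (D : set plane) -> decomposition D D1 D2 -> L2 D f ->
  sqnorm D f = sqnorm D1 f + sqnorm D2 f.
Proof.
move=> mD [[m1 m2] [s1 s2] D12 neg] lf; have [_ fi] := (L2P f).1 lf.
have m12 : measurable (D1 `|` D2 : set plane) by exact: measurableU.
have s12 : D1 `|` D2 `<=` D by rewrite subUset.
have mN : measurable (D `\` (D1 `|` D2) : set plane) by exact: measurableD.
rewrite -(setDUK s12) /sqnorm Rintegral_setU//; last 2 first.
- by rewrite setDUK.
- by apply/disj_setPS => x [Ex [_]].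
(* The interface left out by the two pieces is a null set. *)
rewrite [X in _ + X](_ : _ = 0) ?addr0; last first.
  rewrite /Rintegral null_set_integral//.
    by apply: measurable_funS (measurable_int _ fi) => // x [].
  exact: measure_negligible.
rewrite Rintegral_setU//; first exact: integrableS fi.
by apply/disj_setPS; rewrite D12.
Qed.

Lemma cintegral_mul_conj (R : realType) (D : set (R * R)) (f : cfun) :
  cintegral D (fun x => f x * conjc (f x)) = (sqnorm D f)%:C.
Proof.
apply: complex_eqP; rewrite /cintegral /sqnorm /=.
  apply: eq_Rintegral => x _.
  by rewrite complex_ReM Re_conjc Im_conjc mulrN opprK normc_sqr !expr2.
transitivity (\int[@leb2 R]_(x in D) (0 : R)); last by rewrite /Rintegral integral0.
by apply: eq_Rintegral => x _; rewrite complex_ImM Re_conjc Im_conjc mulrN mulrC addNr.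
Qed.

(** * The Wigner-Seitz cell and the form domain *)

Lemma dot2E (R : realType) (x y : R * R) : dot2 x y = x.1 * y.1 + x.2 * y.2.
Proof. by rewrite /dot2 !big_ord_recl big_ord0 addr0. Qed.

(** The square of [x] cancels, so being closer to 0 than to [l] is an affine condition: the cell is
    an intersection of half-planes. *)
Lemma dot2_ltB (R : realType) (x l : R * R) :
  (dot2 x x < dot2 (x - l) (x - l)) = (2 * dot2 x l < dot2 l l).
Proof.
rewrite !dot2E /= -subr_gt0 -[RHS]subr_gt0; congr (0 < _); ring.
Qed.

Lemma measurable_wigner_seitz (R : realType) (b1 b2 : R * R) :
  measurable (wigner_seitz b1 b2 : set plane).
Proof.
rewrite -[wigner_seitz _ _]setCK; apply: measurableC.
pose l (mn : int * int) : R * R := b1 *~ mn.1 + b2 *~ mn.2.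
(* The complement is a countable union of closed half-planes. The test for 0 is made on the vector
   and not on the indices, because [b1] and [b2] may be linearly dependent here. *)
have -> : ~` wigner_seitz b1 b2 = \bigcup_mn
    (if l mn == 0 then set0 else [set x | dot2 (l mn) (l mn) <= 2 * dot2 x (l mn)]).
  apply/seteqP; split=> [x /= /existsNP[_ /not_implyP[[m [n ->]]]]|x [mn _]].
    move=> /not_implyP[l0] /negP; rewrite dot2_ltB -leNgt => xl.
    by exists (m, n) => //; rewrite /l/= (negbTE l0).
  case: ifPn => // l0 /=; rewrite leNgt -dot2_ltB => /negP xl /(_ (l mn)) h.
  by apply/xl/h => //; exists mn.1, mn.2.
apply: countable_bigcupT_measurable => // mn.
case: ifP => _; first exact: measurable0.
apply: closed_measurable_plane.
rewrite (_ : [set x | _] = (fun x : R * R => 2 * dot2 x (l mn)) @^-1`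
  [set t | dot2 (l mn) (l mn) <= t])//.
apply: preimage_closed; last exact: closed_ge.
move=> x _; under eq_fun do rewrite dot2E.
apply: cvgM; [exact: cvg_cst|apply: cvgD; apply: cvgM]; try exact: cvg_cst.
  exact: cvg_fst.
exact: cvg_snd.
Qed.

(** Comparing with the lattice points [b1], [-b1], [b2], [-b2] bounds the scalar products of [x]
    with [b1] and [b2]. Cramer's rule recovers the coordinates of [x] from them, as the determinant
    is nonzero. *)
Lemma wigner_seitz_sub_cbox (R : realType) (b1 b2 : R * R) :
  b1.1 * b2.2 - b1.2 * b2.1 != 0 ->
  exists M, wigner_seitz b1 b2 `<=` cbox (- M, - M) (M, M).
Proof.
move=> hb; set d := _ - _ in hb.
pose B := dot2 b1 b1 + dot2 b2 b2.
pose N := `|b1.1| + `|b1.2| + `|b2.1| + `|b2.2|.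
have lat1 (e : int) : lattice b1 b2 (b1 *~ e) by exists e, 0; rewrite mulr0z addr0.
have lat2 (e : int) : lattice b1 b2 (b2 *~ e) by exists 0, e; rewrite mulr0z add0r.
have b10 : b1 != 0.
  by apply: contraNneq hb => b10; rewrite /d b10 /= !mul0r subr0.
have b20 : b2 != 0.
  by apply: contraNneq hb => b20; rewrite /d b20 /= !mulr0 subr0.
have bound (b x : R * R) : 2 * dot2 x b < dot2 b b ->
    2 * dot2 x (- b) < dot2 (- b) (- b) -> `|dot2 x b| <= dot2 b b.
  by rewrite !dot2E /= => h1 h2; rewrite ler_norml; apply/andP; split; nra.
have dd (b : R * R) : 0 <= dot2 b b by rewrite dot2E -!expr2 addr_ge0 ?sqr_ge0.
(* [B] bounds both scalar products, [N] the sum of the two matrix entries in each Cramer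
   numerator. *)
exists (B * N / `|d|) => x wx.
have h1 : `|dot2 x b1| <= B.
  rewrite (le_trans (bound b1 x _ _)) ?lerDl//; rewrite -dot2_ltB; apply: wx => //.
  - exact: (lat1 1).
  - exact: (lat1 (-1)).
  - by rewrite oppr_eq0.
have h2 : `|dot2 x b2| <= B.
  rewrite (le_trans (bound b2 x _ _)) ?lerDr//; rewrite -dot2_ltB; apply: wx => //.
  - exact: (lat2 1).
  - exact: (lat2 (-1)).
  - by rewrite oppr_eq0.
have d0 : 0 < `|d| by rewrite normr_gt0.
have B0 : 0 <= B by rewrite addr_ge0.
have cramer (t p q : R) : t * d = dot2 x b1 * p - dot2 x b2 * q ->
    `|p| + `|q| <= N -> `|t| <= B * N / `|d|.
  move=> td pq; rewrite ler_pdivlMr// -normrM td.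
  rewrite (le_trans (ler_normB _ _))// !normrM.
  rewrite (le_trans (lerD (ler_wpM2r (normr_ge0 p) h1) (ler_wpM2r (normr_ge0 q) h2)))//.
  by rewrite -mulrDr ler_wpM2l.
have n1 := normr_ge0 b1.1; have n2 := normr_ge0 b1.2.
have n3 := normr_ge0 b2.1; have n4 := normr_ge0 b2.2.
split; rewrite /= in_itv/= -ler_norml.
  apply: (cramer _ b2.2 b1.2); first by rewrite !dot2E /d; ring.
  by rewrite /N; lra.
apply: (cramer _ (- b2.1) (- b1.1)); first by rewrite !dot2E /d; ring.
by rewrite !normrN /N; lra.
Qed.

Lemma ae_leb2S2 (R : realType) (P Q T : @plane R -> Prop) :
  (forall x, P x -> Q x -> T x) -> {ae leb2, forall x, P x} ->
  {ae leb2, forall x, Q x} -> {ae leb2, forall x, T x}.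
Proof. by move=> PQT aeP aeQ; apply: filterS2 aeP aeQ. Qed.

Lemma pairs_comb_fst (R : realType) (L : nat) (c : R[i]) (z1 z2 : pairs L) :
  (c *: z1 + z2).1 = (fun x => c * z1.1 x + z2.1 x).
Proof. by case: z1 z2 => [u1 x1] [u2 x2]. Qed.

Lemma pairs_comb_snd (R : realType) (L : nat) (c : R[i]) (z1 z2 : pairs L) l :
  (c *: z1 + z2).2 l = (fun x => c * z1.2 l x + z2.2 l x).
Proof. by case: z1 z2 => [u1 x1] [u2 x2]. Qed.

Lemma normc_imag (R : rcfType) (t : R) : Normc.normc (0 +i* t : R[i]) ^+ 2 = t ^+ 2.
Proof. by rewrite normc_sqr/= expr0n add0r. Qed.

(** To be read with [q = k_j^2], [A] the squared norm of [u], [B] that of its partial derivative in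
    direction [j], [C] that of the other one, and [E] the share of the components [x_l]. *)
Lemma gradk_bound (R : realFieldType) (q A B C E : R) : 0 <= q -> 0 <= A -> 0 <= B -> 0 <= C ->
  0 <= E -> 2 * q * A + 2 * B <= (2 * q + 2) * (A + (B + C) + E).
Proof.
move=> q0 A0 B0 C0 E0; rewrite -subr_ge0.
have -> : (2 * q + 2) * (A + (B + C) + E) - (2 * q * A + 2 * B) =
  2 * (q * (B + C + E) + (A + C + E)) by ring.
by rewrite mulr_ge0// !addr_ge0// mulr_ge0// !addr_ge0.
Qed.

Lemma H1loc_comb (R : realType) (c : R[i]) (u v : cfun) :
  H1loc u -> H1loc v -> H1loc (fun x => c * u x + v x).
Proof.
move=> [ul uj] [vl vj]; split; first exact: L2loc_comb.
move=> j; have [g ug] := uj j; have [h vh] := vj j.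
by exists (fun x => c * g x + h x); exact: is_weak_partial_comb.
Qed.

(** The summands are exchanged to reach the shape [c * f + g] of the combination lemmas. *)
Lemma gradkE (R : realType) (k : R * R) (u : cfun) j :
  gradk k u j = (fun x => (0 +i* Defs.coord k j) * u x + weak_partial j u x).
Proof. by apply/funext => x; rewrite addrC. Qed.

Section function_space.
Context {R : realType} {b1 b2 : R * R} {Omega Omega1 Omega2 : set (R * R)} {L : nat}.
Hypotheses (hb : b1.1 * b2.2 - b1.2 * b2.1 != 0)
  (hOmega : Omega = wigner_seitz b1 b2)
  (hdec : decomposition Omega Omega1 Omega2).
Let V := @VX R L b1 b2 Omega1.
Let nrm := @normVX R L Omega Omega2.

Lemma measurable_cell : measurable (Omega : set plane).
Proof. by rewrite hOmega; exact: measurable_wigner_seitz. Qed.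

(** Here the linear independence of [b1] and [b2] enters: it puts the cell inside a compact box. *)
Lemma L2loc_cell (f : cfun) : L2loc f -> L2 Omega f.
Proof.
have [M sM] := wigner_seitz_sub_cbox hb; rewrite -hOmega in sM.
move=> /(_ _ (@compact_cbox R (- M, - M) (M, M))); apply: L2_subset => //.
  exact: measurable_cbox.
exact: measurable_cell.
Qed.

Lemma VX_comb (c : R[i]) z1 z2 : V z1 -> V z2 -> V (c *: z1 + z2).
Proof.
move=> [[u1 per1] x1] [[u2 per2] x2]; split.
  rewrite pairs_comb_fst; split; first exact: H1loc_comb.
  move=> l ll; apply: ae_leb2S2 (per1 _ ll) (per2 _ ll) => x e1 e2.
  by rewrite e1 e2.
move=> l; have [l1 e1] := x1 l; have [l2 e2] := x2 l; rewrite pairs_comb_snd; split.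
  by rewrite -hOmega in l1 l2 *; exact: L2_comb measurable_cell _ _ _ l1 l2.
apply: ae_leb2S2 e1 e2 => x f1 f2 Ox.
by rewrite f1// f2// mulr0 addr0.
Qed.

Lemma normV_sqE u : normV_sq Omega u =
  sqnorm Omega u + \sum_(j < 2) sqnorm Omega (weak_partial j u).
Proof. by []. Qed.

Lemma normVX_sqr z : nrm z ^+ 2 = sqnorm Omega z.1 +
  \sum_(j < 2) sqnorm Omega (weak_partial j z.1) + \sum_(l < L) sqnorm Omega2 (z.2 l).
Proof.
rewrite /nrm /normVX sqr_sqrtr// normV_sqE.
by rewrite !addr_ge0 ?sumr_ge0 ?sqnorm_ge0// => *; exact: sqnorm_ge0.
Qed.

Lemma normVX_ge0 z : 0 <= nrm z. Proof. exact: sqrtr_ge0. Qed.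

Lemma sqrt_sqnorm_le (D : set (R * R)) (f : cfun) (K : R) z :
  sqnorm D f <= K * nrm z ^+ 2 -> Num.sqrt (sqnorm D f) <= Num.sqrt K * nrm z.
Proof.
(* For negative [K] the hypothesis forces [sqnorm D f] to be 0. *)
move=> h; have [K0|K0] := leP 0 K; last first.
  rewrite [X in Num.sqrt X](_ : _ = 0) ?sqrtr0 ?mulr_ge0 ?sqrtr_ge0//.
  apply/le_anti; rewrite sqnorm_ge0 andbT (le_trans h)//.
  by rewrite mulr_le0_ge0 ?sqr_ge0// ltW.
by rewrite -[leRHS]ger0_norm ?mulr_ge0 ?sqrtr_ge0 ?normVX_ge0// -sqrtr_sqr
  exprMn sqr_sqrtr// ler_wsqrtr.
Qed.

Lemma bounded_map_subset (D E : set (R * R)) (P : pairs L -> cfun) :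
  measurable (D : set plane) -> measurable (E : set plane) -> E `<=` D ->
  bounded_map (S := V) (nrm := nrm) D P -> bounded_map (S := V) (nrm := nrm) E P.
Proof.
move=> mD mE ED [lP linP [K HK]]; split=> [z Vz|c z1 z2 V1 V2|].
- exact: L2_subset ED (lP _ Vz).
- by apply: filterS (linP c _ _ V1 V2) => x h /ED.
exists K => z Vz; rewrite (le_trans _ (HK z Vz))// ler_wsqrtr//.
by apply: sqnorm_subset => //; exact: lP.
Qed.

Lemma bounded_map_fst : bounded_map (S := V) (nrm := nrm) Omega (fun z => z.1).
Proof.
split=> [z [[[ul _] _] _]|c z1 z2 _ _|]; first exact: L2loc_cell.
  by rewrite pairs_comb_fst; apply: aeW.
exists (Num.sqrt 1) => z _; apply: sqrt_sqnorm_le; rewrite mul1r normVX_sqr -addrA lerDl.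
by rewrite addr_ge0 ?sumr_ge0// => *; exact: sqnorm_ge0.
Qed.

Lemma bounded_map_snd l : bounded_map (S := V) (nrm := nrm) Omega2 (fun z => z.2 l).
Proof.
have [[m1 m2] [s1 s2] _ _] := hdec.
split=> [z [_ /(_ l)[lx _]]|c z1 z2 _ _|].
- by rewrite -hOmega in lx; apply: L2_subset s2 lx => //; exact: measurable_cell.
- by rewrite pairs_comb_snd; apply: aeW.
exists (Num.sqrt 1) => z _; apply: sqrt_sqnorm_le; rewrite mul1r normVX_sqr.
rewrite (bigD1 l)//= addrCA lerDl.
by rewrite !addr_ge0 ?sqnorm_ge0 ?sumr_ge0// => *; exact: sqnorm_ge0.
Qed.

Lemma L2_weak_partial j u : H1loc u -> L2 Omega (weak_partial j u).
Proof. by move=> /(weak_partialP j)[gl _]; exact: L2loc_cell. Qed.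

Lemma L2_gradk k j u : H1loc u -> L2 Omega (gradk k u j).
Proof.
move=> hu; rewrite gradkE.
apply: L2_comb; [exact: measurable_cell| |exact: L2_weak_partial].
by apply: L2loc_cell; case: hu.
Qed.

Lemma bounded_map_gradk k j :
  bounded_map (S := V) (nrm := nrm) Omega (fun z => gradk k z.1 j).
Proof.
split=> [z [[hu _] _]|c z1 z2 [[h1 _] _] [[h2 _] _]|]; first exact: L2_gradk.
  apply: filterS (weak_partial_comb j c h1 h2) => x e _.
  rewrite pairs_comb_fst /gradk e.
  by rewrite mulrDr mulrDr mulrA mulrA (mulrC c (_ +i* _)) addrACA.
(* The two terms under the root are the factors of the squared norms of [u] and of its weak
   derivative in [sqnorm_comb_le]. *)
exists (Num.sqrt (2 * Defs.coord k j ^+ 2 + 2)) => z [[hu _] _].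
apply: sqrt_sqnorm_le.
rewrite gradkE.
have lu := L2loc_cell hu.1; have lw := L2_weak_partial j hu.
rewrite (le_trans (sqnorm_comb_le _ measurable_cell lu lw))// normc_imag normVX_sqr.
rewrite (bigD1 j)//=; apply: gradk_bound; rewrite ?sqnorm_ge0 ?sqr_ge0//.
  by apply: sumr_ge0 => *; exact: sqnorm_ge0.
by apply: sumr_ge0 => *; exact: sqnorm_ge0.
Qed.

(** The weak derivative is [-i k_j u] plus the [j]-th component of [gradk], so its squared norm is
    at most twice the sum of the squared norms of these two. *)
Lemma sqnorm_gradk_ge k j u : H1loc u ->
  2^-1 * sqnorm Omega (weak_partial j u) - Defs.coord k j ^+ 2 * sqnorm Omega u <=
  sqnorm Omega (gradk k u j).
Proof.
move=> hu; have lu := L2loc_cell hu.1; have lg := L2_gradk k j hu.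
have := sqnorm_comb_le (0 +i* - Defs.coord k j) measurable_cell lu lg.
rewrite normc_imag sqrrN (_ : (fun x => _) = weak_partial j u).
  by move=> h; lra.
apply/funext => x; rewrite gradkE addrA -mulrDl.
have -> : (0 +i* - Defs.coord k j) + (0 +i* Defs.coord k j) = 0 :> R[i].
  by apply: complex_eqP; rewrite /= ?addr0 ?addNr.
by rewrite mul0r add0r.
Qed.

End function_space.

(** * Assembling the form and the Garding inequality *)

Lemma complex_Re_sum (R : rcfType) n (F : 'I_n -> R[i]) :
  complex.Re (\sum_(i < n) F i) = \sum_(i < n) complex.Re (F i).
Proof. by apply: (big_morph (@complex.Re R) (@complex_ReD R)). Qed.

Lemma Re_realM (R : rcfType) (t : R) (z : R[i]) :
  complex.Re (t%:C * z) = t * complex.Re z.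
Proof. by case: z => a b; rewrite complex_ReM /= mul0r subr0. Qed.

Lemma Re_opp (R : rcfType) (z : R[i]) : complex.Re (- z) = - complex.Re z.
Proof. by case: z. Qed.

Lemma conjc_add (R : rcfType) (z w : R[i]) : conjc (z + w) = conjc z + conjc w.
Proof. exact: rmorphD. Qed.

Lemma conjc_opp (R : rcfType) (z : R[i]) : conjc (- z) = - conjc z.
Proof. by case: z. Qed.

Lemma conjc_sum (R : rcfType) n (F : 'I_n -> R[i]) :
  conjc (\sum_(i < n) F i) = \sum_(i < n) conjc (F i).
Proof. exact: rmorph_sum. Qed.

Lemma conjc_realM (R : rcfType) (t : R) (z : R[i]) :
  conjc (t%:C * z) = t%:C * conjc z.
Proof. by rewrite rmorphM; congr (_ * _); exact: conjc_real. Qed.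

(** To be read with [p], [r] the squared norms of [u] on the two subdomains, [s], [t] the weights
    [alpha1], [alpha2], [q = |k|^2], [D] the gradient part and [X] the share of the [x_l]. The three
    summands of the constant absorb [p], [r] and [X] in turn; the cross terms caused by adding them
    have the good sign. *)
Lemma garding_bound (R : realFieldType) (p q r s t D X : R) :
  0 < s -> 0 < t -> 0 <= q -> 0 <= p -> 0 <= r -> 0 <= D -> 0 <= X ->
  2^-1 * (p + r + D + X) -
    ((2^-1 + q) / s + (2^-1 + q) / t + 2^-1) * (s * p + t * r + X) <=
  2^-1 * D - q * (p + r).
Proof.
move=> s0 t0 q0 p0 r0 D0 X0.
set m := (2^-1 + q) / s; set n := (2^-1 + q) / t.
have ms : m * s = 2^-1 + q by rewrite /m divfK// gt_eqF.
have nt : n * t = 2^-1 + q by rewrite /n divfK// gt_eqF.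
have m0 : 0 <= m by rewrite divr_ge0 ?addr_ge0// ltW.
have n0 : 0 <= n by rewrite divr_ge0 ?addr_ge0// ltW.
rewrite -subr_ge0.
have -> : 2^-1 * D - q * (p + r) -
    (2^-1 * (p + r + D + X) - (m + n + 2^-1) * (s * p + t * r + X)) =
  (m * s - (2^-1 + q)) * p + (n * t - (2^-1 + q)) * r +
  (m * (t * r + X) + n * (s * p + X) + 2^-1 * (s * p + t * r)) by field.
rewrite ms nt !subrr !mul0r !add0r.
have sp : 0 <= s * p by rewrite mulr_ge0// ltW.
have tr : 0 <= t * r by rewrite mulr_ge0// ltW.
by rewrite !addr_ge0// mulr_ge0// ?addr_ge0.
Qed.

Theorem lemma4p8 (R : realType) (b1 b2 : R * R)
    (hb : b1.1 * b2.2 - b1.2 * b2.1 != 0)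
    (Omega Omega1 Omega2 : set (R * R))
    (hOmega : Omega = wigner_seitz b1 b2)
    (hdec : decomposition Omega Omega1 Omega2)
    (alpha1 alpha2 : R) (halpha1 : 0 < alpha1) (halpha2 : 0 < alpha2)
    (L : nat) (xi eta : 'I_L -> R) (k : R * R) :
  let a := form_a xi eta k Omega Omega2 in
  let i := @form_i R L alpha1 alpha2 Omega1 Omega2 in
  let V := @VX R L b1 b2 Omega1 in
  let norm := @normVX R L Omega Omega2 in
  [/\ sesquilinear_on V a,
      continuous_form_on V a norm,
      hermitian_on V a,
      (forall z, V z -> complex.Im (a z z) = 0) &
      exists alpha beta : R, [/\ 0 < alpha, 0 <= beta &
        forall z, V z ->
          a z z >= (alpha * norm z ^+ 2)%:C - beta%:C * i z z]].
Proof.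
move=> a i V norm.
have mO := measurable_cell hOmega; have [[m1 m2] [s1 s2] _ _] := hdec.
pose U (z : @pairs R L) : cfun := z.1; pose X l (z : @pairs R L) : cfun := z.2 l.
pose G j (z : @pairs R L) : cfun := gradk k z.1 j.
have bU : bounded_map (S := V) (nrm := norm) Omega U by exact: bounded_map_fst.
have bU2 : bounded_map (S := V) (nrm := norm) Omega2 U.
  exact: (bounded_map_subset mO m2 s2 bU).
have bX l : bounded_map (S := V) (nrm := norm) Omega2 (X l).
  exact: bounded_map_snd.
have bG j : bounded_map (S := V) (nrm := norm) Omega (G j).
  exact: bounded_map_gradk.
pose Xi := \sum_(l < L) xi l ^+ 2.
(* Membership in [V] makes the two components of the gradient term integrable, so that the integral
   of their sum may be split. *)
have aE z1 z2 : V z1 -> V z2 -> a z1 z2 =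
    \sum_(j < 2) pairing Omega (G j) (G j) z1 z2 +
    Xi%:C * pairing Omega2 U U z1 z2 -
    \sum_(l < L) (xi l * eta l)%:C * pairing Omega2 (X l) U z1 z2 -
    \sum_(l < L) (xi l * eta l)%:C * pairing Omega2 U (X l) z1 z2 +
    \sum_(l < L) (eta l ^+ 2)%:C * pairing Omega2 (X l) (X l) z1 z2.
  move=> V1 V2; rewrite /a /form_a; case: z1 z2 V1 V2 => [u x] [v y] V1 V2.
  congr (_ + _ - _ - _ + _).
  have ci j : cintegrable Omega (fun p => gradk k u j p * conjc (gradk k v j p)).
    have [[h1 _] _] := V1; have [[h2 _] _] := V2.
    by apply: L2_cintegrable_mul => //; exact: L2_gradk hb hOmega _ _ _ _.
  rewrite !big_ord_recl big_ord0 addr0 -[pairing _ _ _ _ _]mul1r.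
  rewrite -cintegral_comb; [|exact: mO|exact: ci..].
  by apply: eq_cintegral => p _; rewrite !big_ord_recl big_ord0 addr0 mul1r.
have S_comb := @VX_comb R b1 b2 Omega Omega1 L hOmega.
have ca : continuous_sesquilinear (S := V) (nrm := norm) a.
  apply: (continuous_sesquilinear_ext S_comb aE).
  have cp := continuous_sesquilinear_pairing S_comb.
  apply: continuous_sesquilinearD; last first.
    apply: continuous_sesquilinear_sum => // l.
    by apply: continuous_sesquilinearZ; exact: cp.
  apply: continuous_sesquilinearD; last first.
    apply: continuous_sesquilinearN => //; apply: continuous_sesquilinear_sum => // l.
    by apply: continuous_sesquilinearZ; exact: cp.
  apply: continuous_sesquilinearD; last first.
    apply: continuous_sesquilinearN => //; apply: continuous_sesquilinear_sum => // l.
    by apply: continuous_sesquilinearZ; exact: cp.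
  apply: continuous_sesquilinearD; last first.
    by apply: continuous_sesquilinearZ; exact: cp.
  by apply: continuous_sesquilinear_sum => // j; exact: cp.
have herm : hermitian_on V a.
  move=> z1 z2 V1 V2; rewrite !aE// !(conjc_add, conjc_opp) !conjc_sum.
  have pc D P Q : measurable (D : set plane) -> bounded_map (S := V) (nrm := norm) D P ->
      bounded_map (S := V) (nrm := norm) D Q ->
      conjc (pairing D Q P z2 z1) = pairing D P Q z1 z2.
    by move=> mD bP bQ; rewrite -(pairing_conj mD bP bQ V1 V2).
  rewrite conjc_realM pc//.
  congr (_ + _); last by apply: eq_bigr => l _; rewrite conjc_realM pc.
  (* Conjugation interchanges the two mixed sums. *)
  rewrite [RHS]addrAC; congr (_ + _ - _ - _).
  - by apply: eq_bigr => j _; rewrite pc.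
  - by apply: eq_bigr => l _; rewrite conjc_realM pc.
  - by apply: eq_bigr => l _; rewrite conjc_realM pc.
have real_a z : V z -> complex.Im (a z z) = 0.
  move=> Vz; have /(congr1 (@complex.Im R)) := herm z z Vz Vz.
  by rewrite Im_conjc => h; lra.
split => //; [exact: ca.1|exact: ca.2|].
pose q := \sum_(j < 2) Defs.coord k j ^+ 2.
have q0 : 0 <= q by apply: sumr_ge0 => j _; exact: sqr_ge0.
(* The first constant is the share of the gradient kept in [sqnorm_gradk_ge]; the second is the one
   in [garding_bound]. *)
exists 2^-1, ((2^-1 + q) / alpha1 + (2^-1 + q) / alpha2 + 2^-1); split.
- by rewrite invr_gt0.
- have h0 : 0 <= 2^-1 + q by rewrite addr_ge0// invr_ge0.
  by rewrite addr_ge0 ?invr_ge0// addr_ge0// divr_ge0// ltW.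
move=> z Vz; set beta := _ + 2^-1.
have iE : i z z = (alpha1 * sqnorm Omega1 z.1 + alpha2 * sqnorm Omega2 z.1 +
    \sum_(l < L) sqnorm Omega2 (z.2 l))%:C.
  rewrite /i /form_i /innerX; case: (z) => u x.
  rewrite !cintegral_mul_conj; under eq_bigr do rewrite cintegral_mul_conj.
  by rewrite !rmorphD !rmorphM rmorph_sum.
have ReP D P : complex.Re (pairing (E := @pairs R L) D P P z z) = sqnorm D (P z).
  by rewrite /pairing cintegral_mul_conj.
have hu : H1loc z.1 by case: Vz => [[]].
have lU2 : L2 Omega2 (U z) by case: bU2 => h _ _; exact: h.
have lX l : L2 Omega2 (X l z) by case: (bX l) => h _ _; exact: h.
have ReA : \sum_(j < 2) sqnorm Omega (G j z) <= complex.Re (a z z).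
  rewrite aE// !(complex_ReD, Re_opp) !complex_Re_sum Re_realM ReP.
  rewrite [X in _ <= X + _ - _ - _ + _](eq_bigr _ (fun j _ => ReP Omega (G j))).
  rewrite -!addrA lerDl /Xi mulr_suml -!sumrN -!big_split.
  apply: sumr_ge0 => l _; cbv beta.
  rewrite !Re_realM (ReP Omega2 (X l)).
  (* Both mixed terms have the same real part, so together they form the cross term of the squared
     norm of [xi_l u - eta_l x_l]. *)
  rewrite (pairing_conj m2 bU2 (bX l) Vz Vz) Re_conjc.
  have := sqnorm_ge0 Omega2 (fun x => (- eta l)%:C * X l z x + (xi l)%:C * U z x).
  rewrite sqnorm_comb// -/(pairing Omega2 (X l) U z z).
  move: (complex.Re _) (sqnorm _ _) (sqnorm _ _) (xi l) (eta l) => r s t e f.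
  rewrite sqrrN => h.
  rewrite -[leRHS]/(e ^+ 2 * s + (- (e * f * r) + (- (e * f * r) + f ^+ 2 * t))).
  lra.
have [lO _ _] := bU; have {}lO := lO _ Vz.
have ReG : 2^-1 * (\sum_(j < 2) sqnorm Omega (weak_partial j z.1)) - q * sqnorm Omega z.1 <=
    \sum_(j < 2) sqnorm Omega (G j z).
  rewrite mulr_sumr mulr_suml -sumrB; apply: ler_sum => j _.
  exact: (sqnorm_gradk_ge hb hOmega k j hu).
(* The order on [R[i]] asks for equal imaginary parts, here both 0, and compares the real parts. *)
rewrite lecE iE -rmorphM -rmorphB /= real_a// eqxx/=.
rewrite (le_trans _ ReA)// (le_trans _ ReG)//.
rewrite normVX_sqr (sqnorm_decomposition mO hdec lO).
apply: garding_bound; rewrite ?sqnorm_ge0//.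
  by apply: sumr_ge0 => *; exact: sqnorm_ge0.
by apply: sumr_ge0 => *; exact: sqnorm_ge0.
Qed.
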